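(* Let $(G,o)$ be a non-amenable infinite connected $d$-regular unimodular random graph. Let $\rho:=\|A_G\|$ be the spectral radius of the adjacency operator of $G$. Then for every $\theta>0$ and every $\varepsilon>0$ we have \[\mu_G[\rho(1-\theta),\rho]\lesssim_{d,\rho,\varepsilon}\theta^{\frac{\log d}{\log\rho}-1-\varepsilon},\] that is, $\mu_G[\rho(1-\theta),\rho]\le K\,\theta^{\frac{\log d}{\log\rho}-1-\varepsilon}$ for some constant $K$ that depends only on $d,\rho,\varepsilon$.
   Context: A rooted graph is a pair $(G,o)$ with $G$ a (possibly infinite) graph and $o$ a vertex of $G$. The space of isomorphism classes of rooted graphs of bounded degree carries the metric in which two rooted graphs have distance $2^{-r}$, where $r$ is the largest integer such that the radius-$r$ balls at the roots are isomorphic as rooted graphs; a random rooted graph is a Borel random element of this space. A random rooted graph $(G,o)$ is unimodular if it satisfies the mass transport principle: for every nonnegative Borel measurable function $f_G(x,y)$ on the space of doubly rooted graphs, $\mathbb{E}\sum_{x\in V(G)}f_G(o,x)=\mathbb{E}\sum_{x\in V(G)}f_G(x,o)$. The graph is unweighted, and $A_G$ is its adjacency operator on $\ell^2(V(G))$, given by $(A_G\psi)(x)=\sum_{y\sim x}\psi(y)$. For Borel $E\subseteq\mathbb{R}$, $P^G_E$ denotes the spectral projection of the self-adjoint operator $A_G$ corresponding to $E$, and the spectral distribution is the probability measure $\mu_G(E)=\mathbb{E}\langle 1_o,P^G_E 1_o\rangle$; $\mu_G[a,b]$ means $\mu_G([a,b])$. The number $\rho=\|A_G\|$ (operator norm)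 is treated as a deterministic constant. The non-amenability condition is equivalent to $\rho<d$.
   Formalization: The bound is proved for all ε>0 and θ>0 except pairs with θ>2 and negative exponent log d/log ρ −1−ε; there it fails, e.g. on the 3-regular tree with ε=1, where μ_G=1 for all θ≥2 while θ to a negative power tends to 0. *)

(* Defs.v *)
From HB Require Import structures.
From mathcomp Require Import all_boot all_order all_algebra finmap.
From mathcomp Require Import all_classical all_reals all_analysis.
From mathcomp Require Import measurable_realfun.

Set Implicit Arguments.
Unset Strict Implicit.
Unset Printing Implicit Defensive.
Import Order.TTheory GRing.Theory Num.Theory.
Import numFieldNormedType.Exports.

Local Open Scope classical_set_scope.
Local Open Scope ring_scope.

(* Infinite connected d-regular simple graphs. Such a graph has countably many
   vertices, so up to isomorphism its vertex set is nat. *)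
Record regular_graph (d : nat) := RegularGraph {
  edge : rel nat;
  edge_sym : symmetric edge;
  edge_irrefl : irreflexive edge;
  edge_connected : forall x y, exists2 p, path edge x p & last x p = y;
  edge_regular : forall x, ([set y | edge x y] #= `I_d)%card }.

(* Graphs with k distinguished vertices: rooted graphs for k = 1, doubly rooted
   graphs for k = 2. *)
Definition marked_graph (d k : nat) := (regular_graph d * k.-tuple nat)%type.

Definition rooted_graph (d : nat) := marked_graph d 1.

Definition root d (g : rooted_graph d) : nat := thead g.2.

Definition ball_around d k (g : marked_graph d k) (r : nat) : set nat :=
  [set x | exists o p,
     [/\ o \in g.2, path (edge g.1) o p, last o p = x & (size p <= r)%N]].

Definition ball_iso d k (r : nat) (g h : marked_graph d k) : Prop :=
  exists f : nat -> nat,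
    [/\ set_bij (ball_around g r) (ball_around h r) f,
        map f g.2 = h.2 &
        forall x y, ball_around g r x -> ball_around g r y ->
          edge h.1 (f x) (f y) = edge g.1 x y].

(* Open sets for the distance 2^-r, r being the largest radius with
   ball_iso r g h; the open balls centred at g are the sets
   [set h | ball_iso r g h]. This is a pseudometric on labelled graphs, at
   distance 0 exactly when isomorphic: its Borel sets are the preimages of the
   Borel sets of the space of isomorphism classes. *)
Definition local_open d k (U : set (marked_graph d k)) : Prop :=
  forall g, U g -> exists r, forall h, ball_iso r g h -> U h.

Definition local_borel d k : set (set (marked_graph d k)) :=
  <<s [set U | local_open U] >>.

Definition random_rooted_graph d disp (T : measurableType disp)
    (X : T -> rooted_graph d) : Prop :=
  forall B, local_borel B -> measurable (X @^-1` B).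

Definition borel_function (R : realType) d k
    (f : marked_graph d k -> \bar R) : Prop :=
  forall B : set (\bar R), measurable B -> local_borel (f @^-1` B).

(* The mass transport principle. *)
Definition unimodular (R : realType) d disp (T : measurableType disp)
    (P : probability T R) (X : T -> rooted_graph d) : Prop :=
  forall f : marked_graph d 2 -> \bar R,
    (forall g, 0 <= f g)%E -> borel_function f ->
    (\int[P]_w (\esum_(x in [set: nat]) f ((X w).1, [tuple root (X w); x])) =
     \int[P]_w (\esum_(x in [set: nat]) f ((X w).1, [tuple x; root (X w)])))%E.

(* Positive edge-isoperimetric constant. *)
Definition nonamenable (R : realType) d (G : regular_graph d) : Prop :=
  exists2 c : R, 0 < c & forall F : {fset nat},
    c * (#|` F|)%:R <=
    (\sum_(x <- F) #|` fset_set [set y | edge G x y && (y \notin F)]|)%N%:R.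

Section Hilbert.
Variable R : realType.
Implicit Types (phi psi : nat -> R) (A : (nat -> R) -> nat -> R).

(* The (real) Hilbert space of square-summable functions on the vertices, as
   the L^2 space of the counting measure. *)
Definition l2 psi : Prop := psi \in Lfun (@counting nat R) 2%:E.

Definition inner phi psi : R := \int[@counting nat R]_x (phi x * psi x).

Definition l2norm psi : R := Num.sqrt (inner psi psi).

Definition opnorm A : R :=
  sup [set l2norm (A psi) | psi in [set psi | l2 psi /\ l2norm psi <= 1]].

Definition adjacency d (G : regular_graph d) psi : nat -> R :=
  fun x => \sum_(y \in [set y | edge G x y]) psi y.

Definition orthogonal_projection A : Prop :=
  [/\ forall psi, l2 psi -> l2 (A psi),
      forall a phi psi, l2 phi -> l2 psi ->
        A (a *: phi + psi) = a *: A phi + A psi,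
      forall psi, l2 psi -> A (A psi) = A psi &
      forall phi psi, l2 phi -> l2 psi -> inner (A phi) psi = inner phi (A psi)].

(* P is the projection-valued measure with A = \int x dP(x): by the spectral
   theorem a bounded self-adjoint A has exactly one on Borel sets, and P E is
   then the spectral projection of A corresponding to E. The measure m in the
   last clause is E |-> <psi, P E psi>. *)
Definition spectral_projections A (P : set R -> (nat -> R) -> nat -> R) : Prop :=
  [/\ forall E, measurable E -> orthogonal_projection (P E),
      forall psi, l2 psi -> P setT psi = psi,
      forall E : (set R)^nat, (forall n, measurable (E n)) ->
        trivIset setT E -> forall psi, l2 psi ->
        (fun n => l2norm (P (\bigcup_k E k) psi - \sum_(k < n) P (E k) psi))
          @ \oo --> 0 &
      forall psi, l2 psi -> exists m : {measure set R -> \bar R},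
        [/\ forall E, measurable E -> m E = (inner psi (P E psi))%:E,
            m.-integrable setT (fun x : R => x%:E) &
            ((inner psi (A psi))%:E = \int[m]_x x%:E)%E]].

End Hilbert.

(* PG G E stands for the spectral projection of the adjacency operator of G
   corresponding to E. *)
Definition spectral_distribution (R : realType) d disp (T : measurableType disp)
    (P : probability T R) (X : T -> rooted_graph d)
    (PG : regular_graph d -> set R -> (nat -> R) -> nat -> R)
    (E : set R) : \bar R :=
  (\int[P]_w (inner \1_[set root (X w)]
                (PG (X w).1 E \1_[set root (X w)]))%:E)%E.

(* Main.v *)
Require Import Defs.
From HB Require Import structures.
From mathcomp Require Import all_boot all_order all_algebra finmap.
From mathcomp Require Import all_classical all_reals all_analysis.
From mathcomp Require Import measurable_realfun lra.

Set Implicit Arguments.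
Unset Strict Implicit.
Unset Printing Implicit Defensive.
Import Order.TTheory GRing.Theory Num.Theory.
Import numFieldNormedType.Exports.

Local Open Scope classical_set_scope.
Local Open Scope ring_scope.

(** Write [A] for the adjacency operator and [rho = ||A||].

    A set [S] meeting every ball of radius [r] lowers the spectral radius:
    every vertex off [S] has a closed walk of length [2r] through [S], so
    [A_{G\S}^(2r) <= A^(2r) - 1] entrywise, and [A] restricted to functions
    vanishing on [S] is at most [rho (1 - c)] with [c = rho^(-2r) / (2r)].
    If [theta] is slightly smaller than [c], the range of the spectral
    projection [P] of [[rho (1 - theta), rho]] meets the functions vanishing on
    [S] only in [0]; a dimension count (interlacing) then bounds the trace of
    [P] by the density of [S].  Since [||A^r 1_o||_1 = d^r] and
    [||A^r 1_o||_2 <= rho^r], balls of radius [r] have at least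
    [(d / rho)^(2r)] points, and a Bernoulli set together with the vertices
    that it does not cover is a net of density [O(r (rho / d)^(2r))].  Taking
    [rho^(2r)] to be [1 / theta] up to an [epsilon] in the exponent gives the
    bound.

    The dimension count has to be done with kernels that depend on a finite
    neighbourhood only, so that the mass transport principle applies to them.
    Let [Z = (1 + A / rho) / 2], [F = 1_S Z^n] and [xi_i = (1 - F' F)^i 1_o],
    where [F'] is the adjoint of [F].  Telescoping gives
    [sum_i ||F xi_i||^2 <= 1], and the gap forces [||Z^n xi_i||], hence
    [||P xi_i||], to be tiny for large [i], so that [<1_o, P 1_o>] is at most
    [4 sum_i ||F xi_i||^2] up to a tiny error.  Mass transport replaces
    [F (1 - F' F)^i] by its adjoint [F' (1 - F F')^i], and the transported sum
    vanishes unless [o] is in [S] and is at most [1] otherwise. *)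

(** * Contractions and spectral gaps in an inner product space *)

Section LogConvex.
Variables (R : realFieldType) (a : nat -> R).
Hypothesis a_ge0 : forall k, 0 <= a k.
Hypothesis a_convex : forall k, a k.+1 ^+ 2 <= a k * a k.+2.

(** Log-convexity makes the ratios [a k.+1 / a k] nondecreasing, so a ratio below [u] at [m] forces
    all earlier ones below [u]. *)
Lemma log_convex_decay (u : R) m : 0 < u -> a m.+1 < u * a m ->
  a m <= u ^+ m * a 0%N.
Proof.
move=> u0; elim: m => [|m IH] lt; first by rewrite expr0 mul1r.
have am1 : 0 < a m.+1.
  by rewrite -(pmulr_rgt0 _ u0) (le_lt_trans _ lt).
have am : a m.+1 < u * a m.
  rewrite -(ltr_pM2r am1) -expr2 (le_lt_trans (a_convex m))//.
  have am0 : 0 < a m.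
    rewrite lt_neqAle a_ge0 andbT eq_sym; apply/negP => /eqP am.
    by have := a_convex m; rewrite am mul0r leNgt exprn_gt0.
  by rewrite [u * _]mulrC -mulrA ltr_pM2l.
by rewrite exprS -mulrA (le_trans (ltW am))// ler_pM2l// IH.
Qed.

(** The same monotonicity read upwards: an initial ratio above [u] persists. *)
Lemma log_convex_growth (u : R) m : 0 <= u -> u * a 0%N < a 1%N ->
  u * a m < a m.+1 /\ u ^+ m * a 0%N <= a m.
Proof.
move=> u0 lt0; elim: m => [|m [IH1 IH2]]; first by rewrite expr0 mul1r.
have am1 : 0 < a m.+1 by apply: le_lt_trans IH1; rewrite mulr_ge0.
split; last first.
  rewrite exprS -mulrA (le_trans _ (ltW IH1))//.
  by rewrite ler_wpM2l.
have am0 : 0 < a m.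
  rewrite lt_neqAle a_ge0 andbT eq_sym; apply/negP => /eqP am.
  by have := a_convex m; rewrite am mul0r leNgt exprn_gt0.
rewrite -(ltr_pM2l am0) (lt_le_trans _ (a_convex m))// mulrA [a m * u]mulrC.
by rewrite expr2 ltr_pM2r.
Qed.

End LogConvex.

(** * Semidefinite forms and Cauchy-Schwarz *)

Section PsdForm.
Variables (R : realFieldType) (V : lmodType R).
Implicit Types (b : V -> V -> R) (x y z : V).

(** Only semidefiniteness is asked for, so that Cauchy-Schwarz also serves for forms such as
    [<x, Z y>] and [<x, y - T y>]. *)
Definition psd_form b :=
  [/\ forall x y, b x y = b y x,
      forall c x y z, b (c *: x + y) z = c * b x z + b y z &
      forall x, 0 <= b x x].

Variable b : V -> V -> R.
Hypothesis bP : psd_form b.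

Lemma psdC x y : b x y = b y x. Proof. by case: bP. Qed.
Lemma psd_ge0 x : 0 <= b x x. Proof. by case: bP. Qed.

Lemma psdDl x y z : b (x + y) z = b x z + b y z.
Proof. by case: bP => _ l _; rewrite -[x]scale1r l mul1r scale1r. Qed.

Lemma psdZl c x z : b (c *: x) z = c * b x z.
Proof.
case: bP => _ l _; have := l c x 0 z; rewrite addr0 => ->.
have := l 1 0 0 z; rewrite scale1r addr0 mul1r => /eqP.
by rewrite -subr_eq subrr => /eqP <-; rewrite addr0.
Qed.

Lemma psdBl x y z : b (x - y) z = b x z - b y z.
Proof. by rewrite psdDl -scaleN1r psdZl mulN1r. Qed.

Lemma psdDr x y z : b x (y + z) = b x y + b x z.
Proof. by rewrite !(psdC x) psdDl. Qed.

Lemma psdBr x y z : b x (y - z) = b x y - b x z.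
Proof. by rewrite !(psdC x) psdBl. Qed.

Lemma psdZr c x z : b x (c *: z) = c * b x z.
Proof. by rewrite !(psdC x) psdZl. Qed.

Lemma psd_normB x y : b (x - y) (x - y) = b x x - 2 * b x y + b y y.
Proof. by rewrite psdBl !psdBr (psdC y x); lra. Qed.

Lemma psd_normD x y : b (x + y) (x + y) = b x x + 2 * b x y + b y y.
Proof. by rewrite psdDl !psdDr (psdC y x); lra. Qed.

Lemma psd_normB_le x y : b (x - y) (x - y) <= 2 * b x x + 2 * b y y.
Proof. by have := psd_ge0 (x + y); rewrite psd_normB psd_normD; lra. Qed.

Lemma psd_CauchySchwarz x y : b x y ^+ 2 <= b x x * b y y.
Proof.
have := psd_ge0 x; rewrite le_eqVlt => /orP[/eqP x0|x0].
  have key t : 0 <= t * 2 * b x y + b y y.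
    by have := psd_ge0 (t *: x + y);
       rewrite psd_normD psdZl psdZr psdZl -x0; lra.
  have [->|xy0] := eqVneq (b x y) 0; first by rewrite -x0 mul0r expr0n.
  (* At this [t] the affine lower bound equals [-1], a contradiction. *)
  have := key (- (b y y + 1) / (2 * b x y)).
  by rewrite -mulrA -[2 * _]mulrC -mulrA mulVf ?mulf_neq0//; lra.
have := psd_ge0 (y - (b x y / b x x) *: x).
rewrite psd_normB !psdZl !psdZr (psdC y x).
have -> : b y y - 2 * (b x y / b x x * b x y) +
    b x y / b x x * (b x y / b x x * b x x) = b y y - b x y ^+ 2 / b x x.
  by rewrite divfK ?gt_eqF// expr2 (mulrAC _ _ (b x y)); lra.
by rewrite subr_ge0 ler_pdivrMr// mulrC.
Qed.

End PsdForm.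

(** * Adjoints, contractions and deflation *)

Section Operators.
Variables (R : realFieldType) (V : lmodType R) (ip : V -> V -> R).
Hypothesis ipP : psd_form ip.
Implicit Types (x y : V) (F G : V -> V).

Local Notation N x := (ip x x).

Definition adjoint F G := forall x y, ip (F x) y = ip x (G y).

Lemma adjoint_sym F G : adjoint F G -> adjoint G F.
Proof. by move=> FG x y; rewrite (psdC ipP) -FG (psdC ipP). Qed.

Lemma adjoint_comp F G F' G' :
  adjoint F G -> adjoint F' G' -> adjoint (F \o F') (G' \o G).
Proof. by move=> a a' x y /=; rewrite a a'. Qed.

Lemma adjoint_iter n F : adjoint F F -> adjoint (iter n F) (iter n F).
Proof.
move=> FF; elim: n => [|n IH] x y //.
by rewrite iterS iterSr FF IH.
Qed.

Lemma contraction_iter n F : (forall x, N (F x) <= N x) ->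
  forall x, N (iter n F x) <= N x.
Proof.
by move=> Fc; elim: n => // n IH x; rewrite iterS (le_trans (Fc _)).
Qed.

(** By Cauchy-Schwarz, [N (G x) ^ 2 = <F (G x), x> ^ 2 <= N (G x) * N x]. *)
Lemma contraction_adjoint F G x : adjoint F G -> (forall y, N (F y) <= N y) ->
  N (G x) <= N x.
Proof.
move=> FG Fc; have := psd_CauchySchwarz ipP (F (G x)) x.
rewrite FG; have := Fc (G x); have := psd_ge0 ipP x; have := psd_ge0 ipP (G x).
rewrite le_eqVlt => /orP[/eqP <- //|]; nra.
Qed.

(** With [G] adjoint to [F] this is [1 - F' F], whose iterates damp what [F] sees. *)
Definition deflate (F G : V -> V) x := x - G (F x).

Section Deflation.
Variables F G : V -> V.
Hypothesis FG : adjoint F G.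
Hypothesis F_contr : forall x, N (F x) <= N x.

Local Notation xi i x := (iter i (deflate F G) x).

Let GF := adjoint_sym FG.
Let G_contr x := contraction_adjoint x FG F_contr.

Lemma deflate_sym : adjoint (deflate F G) (deflate F G).
Proof. by move=> x y; rewrite /deflate (psdBl ipP) (psdBr ipP) GF FG. Qed.

(** Expanding gives [N x - 2 N (F x) + N (G (F x))], whose last term lies between [0] and
    [N (F x)]. *)
Lemma deflate_norm x :
  N x - 2 * N (F x) <= N (deflate F G x) <= N x - N (F x).
Proof.
rewrite /deflate (psd_normB ipP) -FG.
have := G_contr (F x); have := psd_ge0 ipP (G (F x)); lra.
Qed.

Lemma deflate_contraction x : N (deflate F G x) <= N x.
Proof. by have := deflate_norm x; have := psd_ge0 ipP (F x); lra. Qed.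

Lemma deflate_sum_le M x :
  \sum_(i < M) N (F (xi i x)) <= N x - N (xi M x).
Proof.
elim: M => [|M IH]; first by rewrite big_ord0 subrr.
rewrite big_ord_recr iterS /=; have := deflate_norm (xi M x); lra.
Qed.

Lemma deflate_sum_ge M x :
  N x - N (xi M x) <= 2 * \sum_(i < M) N (F (xi i x)).
Proof.
elim: M => [|M IH]; first by rewrite big_ord0 subrr mulr0.
rewrite big_ord_recr iterS /=; have := deflate_norm (xi M x); lra.
Qed.

(** [F (1 - G F) = (1 - F G) F], and [1 - F G] does not increase norms. Additivity of [F] is
    obtained inside the form, through its adjoint. *)
Lemma deflate_form_decr x : N (F (deflate F G x)) <= N (F x).
Proof.
have -> : N (F (deflate F G x)) =
    N (F x) - 2 * N (G (F x)) + N (F (G (F x))).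
  have Fl z : ip (F (deflate F G x)) z = ip (F x) z - ip (F (G (F x))) z.
    by rewrite FG /deflate (psdBl ipP) -!FG.
  rewrite Fl !(psdC ipP _ (F (deflate F G x))) !Fl.
  by rewrite (psdC ipP (F x) (F (G _))) (FG (G (F x))); lra.
have := F_contr (G (F x)); have := psd_ge0 ipP (G (F x)); lra.
Qed.

(** The terms [N (F (xi i x))] decrease in [i], and the first [M] of them sum to at most [N x]. *)
Lemma deflate_form_le M x : M%:R * N (F (xi M x)) <= N x.
Proof.
apply: le_trans (_ : \sum_(i < M) N (F (xi i x)) <= _); last first.
  by have := deflate_sum_le M x; have := psd_ge0 ipP (xi M x); lra.
have <- : \sum_(i < M) N (F (xi M x)) = M%:R * N (F (xi M x)).
  by rewrite sumr_const card_ord mulr_natl.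
apply: ler_sum => i _; move: (ltnW (ltn_ord i)).
move: (nat_of_ord i) => j /subnK <-; elim: (M - j)%N => // k IH.
by rewrite addSn iterS (le_trans (deflate_form_decr _)).
Qed.

(** Let [D] be the deflation. The even exponent turns the cross term into a norm: [<x, D^(2M) x> = N
    (D^M x) >= N (D^(2M) x)]. The distance is thus at most [N x - N (D^M x)], which telescopes. *)
Lemma deflate_dist_le M x :
  N (x - xi (M + M) x) <= 2 * \sum_(i < M) N (F (xi i x)).
Proof.
rewrite (psd_normB ipP) iterD -(adjoint_iter M deflate_sym).
have := contraction_iter M deflate_contraction (xi M x).
have := deflate_sum_ge M x; lra.
Qed.

End Deflation.

(** Averaging with the identity moves a spectrum in [[-1, 1]] to [[0, 1]], so that all moments are
    nonnegative. *)
Definition lazy (T : V -> V) x := 2^-1 *: (x + T x).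

(** * Dimension count from a spectral gap *)

Section SpectralBound.
Variables T B P : V -> V.
Variables (th0 c : R).
Hypothesis T_sym : adjoint T T.
Hypothesis T_norm : forall x, `|ip x (T x)| <= N x.
Hypothesis B_sym : adjoint B B.
Hypothesis B_idem : forall x, B (B x) = B x.
Hypothesis th0_gt0 : 0 < th0.
Hypothesis th0_le1 : th0 <= 1.
Hypothesis gap : forall x,
  ip (x - B x) (T (x - B x)) <= (1 - th0) * N (x - B x).
Hypothesis P_sym : adjoint P P.
Hypothesis P_norm : forall x, N (P x) = ip x (P x).
Hypothesis c_ge0 : 0 <= c.
Hypothesis P_lazy : forall x, c * N (P x) <= N (P (lazy T x)).

Local Notation Z := (lazy T).

Lemma P_contr x : N (P x) <= N x.
Proof.
have := psd_CauchySchwarz ipP x (P x); rewrite -P_norm.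
have := psd_ge0 ipP x; have := psd_ge0 ipP (P x).
rewrite le_eqVlt => /orP[/eqP <- //|]; nra.
Qed.

Lemma B_norm x : ip x (B x) = N (B x).
Proof. by rewrite B_sym B_idem. Qed.

Lemma B_pythagoras x : N x = N (B x) + N (x - B x).
Proof. by rewrite (psd_normB ipP) B_norm; lra. Qed.

Lemma B_contr x : N (B x) <= N x.
Proof. by rewrite [leRHS]B_pythagoras lerDl (psd_ge0 ipP). Qed.

Lemma lazy_sym : adjoint Z Z.
Proof.
move=> x y.
by rewrite /lazy (psdZl ipP) (psdZr ipP) (psdDl ipP) (psdDr ipP) T_sym.
Qed.

Lemma lazy_ge0 x : 0 <= ip x (Z x).
Proof.
by rewrite /lazy (psdZr ipP) (psdDr ipP); have := T_norm x;
   rewrite ler_norml; lra.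
Qed.

Lemma lazy_psd : psd_form (fun x y => ip x (Z y)).
Proof.
split=> [x y|a x y z|]; last exact: lazy_ge0.
- by rewrite -lazy_sym (psdC ipP).
- by rewrite (psdDl ipP) (psdZl ipP).
Qed.

(** Cauchy-Schwarz for the form [<x, Z y>] at [x] and [Z x]: [N (Z x) ^ 2 <= <x, Z x> <Z x, Z (Z x)>
    <= N x * N (Z x)]. *)
Lemma lazy_contr x : N (Z x) <= N x.
Proof.
have := psd_CauchySchwarz lazy_psd x (Z x).
have : ip x (Z x) <= N x.
  by rewrite /lazy (psdZr ipP) (psdDr ipP); have := T_norm x;
     rewrite ler_norml; lra.
have : ip (Z x) (Z (Z x)) <= N (Z x).
  rewrite {2}/lazy (psdZr ipP) (psdDr ipP); have := T_norm (Z x).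
  by rewrite ler_norml; lra.
rewrite -!lazy_sym.
have := lazy_ge0 x; have := lazy_ge0 (Z x); have := psd_ge0 ipP (Z x).
rewrite -!lazy_sym le_eqVlt => /orP[/eqP <- *|]; first exact: (psd_ge0 ipP).
nra.
Qed.

Lemma iter_lazy_contr n x : N (iter n Z x) <= N x.
Proof. exact: contraction_iter lazy_contr x. Qed.

Lemma P_iter_lazy n x : c ^+ n * N (P x) <= N (iter n Z x).
Proof.
apply: le_trans (P_contr _); elim: n x => [|n IH] x.
  by rewrite expr0 mul1r.
rewrite exprSr -mulrA iterSr (le_trans _ (IH _))//.
by rewrite ler_wpM2l ?exprn_ge0.
Qed.

(* The moments [ip x (Z^k x)] are log-convex: either two consecutive ones have
   ratio at least [1 - lam], or all the previous ratios were smaller. *)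
Lemma lazy_moments n (lam : R) x : 0 <= lam -> lam < 1 ->
  ip (iter n Z x) (iter n Z x) - ip (iter n Z x) (Z (iter n Z x)) <=
  lam * N (iter n Z x) + (1 - lam) ^+ (n + n) * N x.
Proof.
move=> lam0 lam1; pose a k := ip x (iter k Z x).
have aD i j : ip (iter i Z x) (iter j Z x) = a (i + j)%N.
  by rewrite (adjoint_iter i lazy_sym) /a iterD.
(* Even moments are norms of some [Z^j x] and odd ones are values of the form of [Z]; the same
   parity split gives log-convexity. *)
have a_ge0 k : 0 <= a k.
  rewrite -(odd_double_half k) -addnn addnA addnC -aD.
  case: (odd k); rewrite ?(psd_ge0 ipP)//= /=; exact: lazy_ge0.
have a_convex k : a k.+1 ^+ 2 <= a k * a k.+2.
  have := odd_double_half k; rewrite -addnn; set j := k./2.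
  case: (odd k) => /= <-.
    have := psd_CauchySchwarz lazy_psd (iter j Z x) (iter j.+1 Z x).
    by rewrite -!iterS !aD !addnS !addSn.
  have := psd_CauchySchwarz ipP (iter j Z x) (iter j.+1 Z x).
  by rewrite !aD !addnS !addSn.
rewrite -iterS !aD addnS.
have [lt|ge] := ltP (a (n + n).+1) ((1 - lam) * a (n + n)%N).
  have := log_convex_decay a_ge0 a_convex _ lt.
  have := a_ge0 (n + n).+1; have := a_ge0 (n + n)%N.
  rewrite [a 0%N]/a /=; nra.
have : 0 <= (1 - lam) ^+ (n + n) * N x.
  by rewrite mulr_ge0 ?(psd_ge0 ipP)// exprn_ge0// subr_ge0 ltW.
lra.
Qed.

(** Let [D x = N x - <x, T x>], a semidefinite form. The gap gives [th0 N (x - B x) <= D (x - B x)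
    <= 2 D x + 2 D (B x)]. With [D (B x) <= 2 N (B x)] and [th0 N (B x) <= N (B x)] the constant is
    [5]. *)
Lemma gap_form x :
  th0 * N x <= 2 * (N x - ip x (T x)) + 5 * N (B x).
Proof.
have DP : psd_form (fun x y => ip x y - ip x (T y)).
  split=> [y z|a y z t|y]; last by have := T_norm y; rewrite ler_norml; lra.
  - by rewrite -T_sym (psdC ipP) (psdC ipP (T _)).
  - by rewrite !(psdDl ipP) !(psdZl ipP); lra.
have /= := psd_normB_le DP x (B x); have := gap x.
have := T_norm (B x); rewrite ler_norml => /andP[TB _].
have : th0 * N (B x) <= N (B x) by rewrite ler_piMl// (psd_ge0 ipP).
have -> : th0 * N x = th0 * N (B x) + th0 * N (x - B x).
  by rewrite -mulrDr -B_pythagoras.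
lra.
Qed.

(** Split [x] into [x - y] and [y], the [2M]-th deflation of [x]. The sum bounds the first part; the
    second is nearly invisible to [B Z^n], so the gap forces [Z^n y], and with it [P y], to be
    small. *)
Lemma spectral_bound n M x : (0 < M)%N ->
  c ^+ n * N (P x) <=
  4 * c ^+ n * (\sum_(i < M)
    N (B (iter n Z (iter i (deflate (B \o iter n Z) (iter n Z \o B)) x)))) +
  4 / th0 * (4 * (1 - th0 / 8) ^+ (n + n) + 5 / (M + M)%:R) * N x.
Proof.
move=> M0; set F := B \o iter n Z; set G := iter n Z \o B.
have FG : adjoint F G by apply: adjoint_comp => //; apply/adjoint_iter/lazy_sym.
have F_contr y : N (F y) <= N y by rewrite (le_trans (B_contr _))// iter_lazy_contr.
set y := iter (M + M) (deflate F G) x.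
have xy := deflate_dist_le FG F_contr M x; rewrite -/y in xy.
have Py : N (P x) <= 2 * N (P (x - y)) + 2 * N (P y).
  have Pl z t : ip (P (z - t)) (P (z - t)) = N (P z - P t).
    have Pl u : ip (P (z - t)) u = ip (P z) u - ip (P t) u.
      by rewrite !P_sym (psdBl ipP).
    by rewrite (psd_normB ipP) Pl !(psdC ipP _ (P (z - t))) !Pl
      (psdC ipP (P t)); lra.
  have := psd_ge0 ipP (P x - P y - P y).
  by rewrite Pl !(psdBl ipP, psdBr ipP) (psdC ipP (P y)); lra.
have cPy : c ^+ n * N (P y) <= N (iter n Z y) by exact: P_iter_lazy.
have psi_small : th0 * N (iter n Z y) <=
    8 * (1 - th0 / 8) ^+ (n + n) * N x + 10 / (M + M)%:R * N x.
  (* The moment bound enters [gap_form] with weight [4], so [lam = th0 / 8] lets half of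
     [th0 * N psi] be absorbed on the left. *)
  have lam0 : 0 <= th0 / 8 by rewrite divr_ge0// ltW.
  have lam1 : th0 / 8 < 1.
    by rewrite ltr_pdivrMr// mul1r (le_lt_trans th0_le1)// ltr1n.
  have th0E : th0 = 8 * (th0 / 8) by rewrite mulrC divfK.
  have := lazy_moments n y lam0 lam1; have := gap_form (iter n Z y).
  set psi := iter n Z y.
  have -> : ip psi (Z psi) = 2^-1 * (N psi + ip psi (T psi)).
    by rewrite /lazy (psdZr ipP) (psdDr ipP).
  have y_le : N y <= N x.
    exact: contraction_iter (deflate_contraction FG F_contr) x.
  have w0 : 0 <= (1 - th0 / 8) ^+ (n + n) by rewrite exprn_ge0// subr_ge0 ltW.
  have MM : 0 < (M + M)%:R :> R by rewrite ltr0n addn_gt0 M0.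
  have : N (B psi) <= N x / (M + M)%:R.
    by rewrite ler_pdivlMr// mulrC; exact: (deflate_form_le FG F_contr (M + M) x).
  have := ler_wpM2l w0 y_le.
  have -> : th0 * N psi = 8 * (th0 / 8 * N psi) by rewrite mulrA -th0E.
  have -> : 10 / (M + M)%:R * N x = 10 * (N x / (M + M)%:R).
    by rewrite mulrAC mulrA.
  rewrite -(mulrA 8).
  move: (N x / _) (th0 / 8 * N psi) (_ * N y) (_ * N x) => e f g h.
  lra.
have cn0 : 0 <= c ^+ n by rewrite exprn_ge0.
have := ler_wpM2l cn0 Py.
have := ler_wpM2l cn0 (le_trans (P_contr (x - y)) xy).
have : N (iter n Z y) <= th0^-1 * (8 * (1 - th0 / 8) ^+ (n + n) * N x +
    10 / (M + M)%:R * N x).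
  by rewrite ler_pdivlMl.
move: cPy; rewrite /F /G /=.
move: (\sum_(_ < M) _) ((1 - th0 / 8) ^+ (n + n)) (M + M)%:R^-1 th0^-1 (c ^+ n).
move=> S w m t q; lra.
Qed.

End SpectralBound.
End Operators.

(** * The adjacency operator on square-summable functions *)

Definition series_of (R : realType) (f : nat -> R) : \bar R :=
  (\sum_(k <oo) (f k)%:E)%E.

Definition sum_sq (R : realType) (f : nat -> R) : \bar R :=
  series_of (fun x => f x ^+ 2).

Section SeriesOf.
Variable R : realType.
Implicit Types f g : nat -> R.

Lemma series_of_ge0 f : (forall x, 0 <= f x) -> (0 <= series_of f)%E.
Proof. by move=> f0; apply: nneseries_ge0 => k _ _; rewrite lee_fin. Qed.

Lemma le_series_of f g : (forall x, 0 <= f x) -> (forall x, f x <= g x) ->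
  (series_of f <= series_of g)%E.
Proof.
by move=> f0 fg; apply: lee_nneseries => k *; rewrite lee_fin.
Qed.

Lemma series_ofZ (c : R) f : (forall x, 0 <= f x) ->
  series_of (fun x => c * f x) = (c%:E * series_of f)%E.
Proof.
move=> f0; rewrite -nneseriesZl//.
by move=> k _; rewrite lee_fin.
Qed.

Lemma series_ofD f g : (forall x, 0 <= f x) -> (forall x, 0 <= g x) ->
  series_of (fun x => f x + g x) = (series_of f + series_of g)%E.
Proof.
by move=> f0 g0; rewrite -nneseriesD// => k _ _; rewrite lee_fin.
Qed.

Lemma series_of_esum f : (forall x, 0 <= f x) ->
  series_of f = (\esum_(x in [set: nat]) (f x)%:E)%E.
Proof. by move=> f0; rewrite -nneseries_esumT// => k; rewrite lee_fin. Qed.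

Lemma le_series_of_term f x : (forall x, 0 <= f x) ->
  ((f x)%:E <= series_of f)%E.
Proof.
move=> f0; rewrite series_of_esum// -(@esum_set1 _ _ x (fun x => (f x)%:E)).
  rewrite (esum_mkcond [set x]); apply: le_esum => k _.
  by case: ifP; rewrite lee_fin.
by rewrite lee_fin.
Qed.

End SeriesOf.

Section L2.
Variable R : realType.
Implicit Types (phi psi f g : nat -> R).

Lemma l2P psi : l2 psi <-> (sum_sq psi < +oo)%E.
Proof.
rewrite /sum_sq /series_of -(@ge0_integral_count R (fun k => (psi k ^+ 2)%:E));
  last by move=> k; rewrite lee_fin sqr_ge0.
split=> [/Lfun2_integrable_sqr /integrableP[_]|fin].
  by under eq_integral do rewrite gee0_abs ?lee_fin ?sqr_ge0//.
rewrite /l2 inE; apply/andP; split; rewrite inE//=.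
rewrite /finite_norm unlock /=; apply: poweR_lty.
rewrite (eq_integral (fun k => (psi k ^+ 2)%:E))// => k _ /=.
by rewrite powR_mulrn// real_normK ?num_real.
Qed.

Lemma le_l2 phi psi : (forall x, `|phi x| <= `|psi x|) -> l2 psi -> l2 phi.
Proof.
move=> le /l2P fin; apply/l2P; apply: le_lt_trans fin.
apply: le_series_of => x; first exact: sqr_ge0.
by rewrite -(real_normK (num_real (phi x))) -(real_normK (num_real (psi x)))
  lerXn2r ?nnegrE.
Qed.

Lemma l2_integrable phi psi : l2 phi -> l2 psi ->
  (@counting nat R).-integrable setT (EFin \o (phi \* psi)).
Proof. by move=> l l'; apply/Lfun1_integrable/Lfun2_mul_Lfun1. Qed.

Lemma le12E : (1 <= 2%:E :> \bar R)%E.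
Proof. by rewrite lee_fin ler1n. Qed.

(** The bundled type carries the module structure over which the abstract operator results are
    stated. *)
Definition ell2 := LfunType (@counting nat R) le12E.

Definition to_ell2 psi (h : l2 psi) : ell2 := Lfun_Sub le12E h.

Lemma ell2_l2 (u : ell2) : l2 u.
Proof. exact: LfunP. Qed.

Lemma l2Z c psi : l2 psi -> l2 (c *: psi).
Proof. move=> h; exact: (ell2_l2 (c *: to_ell2 h)). Qed.

Lemma inner_psd : psd_form (fun u v : ell2 => inner u v).
Proof.
split=> [u v|c u v w|u].
- by apply: eq_Rintegral => x _; rewrite mulrC.
- have lu := ell2_l2 u; have lw := ell2_l2 w.
  rewrite /inner -RintegralZl//; last exact: l2_integrable.
  rewrite -RintegralD//.
  + by apply: eq_Rintegral => x _ /=; rewrite mulrDl -mulrA.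
  + rewrite (_ : _ \o _ = EFin \o ((c *: (u : nat -> R)) \* w)).
      exact: l2_integrable (l2Z c lu) lw.
    by apply/funext => x /=; rewrite mulrA.
  + exact: l2_integrable (ell2_l2 _) lw.
- by apply: Rintegral_ge0 => x _; rewrite -expr2 sqr_ge0.
Qed.

Definition ip2 (u v : ell2) : R := inner u v.

Lemma ip2_psd : psd_form ip2.
Proof. exact: inner_psd. Qed.

Lemma inner_series phi psi : l2 phi -> l2 psi -> (forall x, 0 <= phi x * psi x) ->
  (inner phi psi)%:E = series_of (fun x => phi x * psi x).
Proof.
move=> lphi lpsi h; rewrite /series_of -ge0_integral_count; last first.
  by move=> k; rewrite lee_fin.
rewrite /inner /Rintegral fineK//.
exact: integrable_fin_num (l2_integrable lphi lpsi).
Qed.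

Lemma inner_normE psi : l2 psi ->
  (inner psi psi)%:E = sum_sq psi.
Proof.
by move=> h; rewrite inner_series// => x; rewrite -expr2 sqr_ge0.
Qed.

Lemma sqr_le_inner psi x : l2 psi -> psi x ^+ 2 <= inner psi psi.
Proof.
move=> h; rewrite -lee_fin inner_normE//.
by apply: (le_series_of_term (f := fun x => psi x ^+ 2)) => y; rewrite sqr_ge0.
Qed.

Lemma le_inner f f' g g' : l2 f -> l2 f' -> l2 g -> l2 g' ->
  (forall x, f x * g x <= f' x * g' x) -> inner f g <= inner f' g'.
Proof.
by move=> lf lf' lg lg' h; apply: le_Rintegral => //;
  apply: l2_integrable.
Qed.

Lemma sum_sq_indic x : sum_sq (\1_[set x] : nat -> R) = 1%E.
Proof.
rewrite /sum_sq series_of_esum; last by move=> y; rewrite sqr_ge0.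
rewrite -(@esum_set1 R _ x (fun=> 1%E))// (esum_mkcond [set x]).
apply: eq_esum => y _; rewrite indicE.
by case: (y \in _); rewrite ?expr1n ?expr0n.
Qed.

Lemma l2_indic x : l2 (\1_[set x] : nat -> R).
Proof. by apply/l2P; rewrite sum_sq_indic ltry. Qed.

Lemma inner_indic_norm x : inner \1_[set x] (\1_[set x] : nat -> R) = 1.
Proof.
by apply: EFin_inj; rewrite inner_normE ?sum_sq_indic//; exact: l2_indic.
Qed.

Lemma inner_indic psi x : l2 psi -> inner \1_[set x] psi = psi x.
Proof.
move=> lpsi; have lx := l2_indic x.
rewrite -[RHS]mulr1 -(inner_indic_norm x) /inner -RintegralZl//.
  apply: eq_Rintegral => y _; rewrite indicE.
  have [->|yx] := eqVneq y x; first by rewrite mem_set// mul1r !mulr1.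
  by rewrite memNset ?mul0r ?mulr0// => /eqP; rewrite (negbTE yx).
exact: l2_integrable.
Qed.

End L2.

(** * Boundedness and self-adjointness of the adjacency operator *)

Section Adjacency.
Variables (R : realType) (d : nat) (G : regular_graph d).
Implicit Types (phi psi f g : nat -> R) (x y : nat).

Local Notation A := (adjacency G : (nat -> R) -> nat -> R).

Lemma nbrs_finite x : finite_set [set y | edge G x y].
Proof. by exists d; exact: edge_regular. Qed.

Definition nbrs x : {fset nat} := fset_set [set y | edge G x y].

Lemma in_nbrs x y : (y \in nbrs x) = edge G x y.
Proof.
rewrite in_fset_set; last exact: nbrs_finite.
by apply/idP/idP => [/set_mem//|/mem_set].
Qed.

Lemma size_nbrs x : size (nbrs x) = d.
Proof. exact: card_fset_set (edge_regular G x). Qed.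

Lemma adjacencyE psi x : A psi x = \sum_(y <- nbrs x) psi y.
Proof. by rewrite /adjacency fsbig_finite//; exact: nbrs_finite. Qed.

Lemma adjacency_linear c phi psi : A (c *: phi + psi) = c *: A phi + A psi.
Proof.
apply/funext => x; rewrite adjacencyE/= !fctE !adjacencyE/=.
by rewrite scaler_sumr -big_split.
Qed.

Lemma adjacency_ge0 f x : (forall y, 0 <= f y) -> 0 <= A f x.
Proof. by move=> f0; rewrite adjacencyE sumr_ge0. Qed.

Lemma le_adjacency f g x : (forall y, f y <= g y) -> A f x <= A g x.
Proof. by move=> fg; rewrite !adjacencyE ler_sum. Qed.

Lemma adjacency_norm_le psi x : `|A psi x| <= A (fun y => `|psi y|) x.
Proof. by rewrite !adjacencyE ler_norm_sum. Qed.

Lemma le_adjacency_term f x y : (forall z, 0 <= f z) -> edge G x y -> f y <= A f x.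
Proof.
move=> f0 xy; rewrite adjacencyE (big_fsetD1 y) ?in_nbrs//=.
by rewrite lerDl sumr_ge0.
Qed.

Lemma adjacency_series f x : (forall z, 0 <= f z) ->
  (A f x)%:E = series_of (fun y => (edge G x y)%:R * f y).
Proof.
move=> f0; rewrite series_of_esum; last by move=> y; rewrite mulr_ge0.
rewrite /adjacency -fsumEFin; last exact: nbrs_finite.
rewrite -esum_fset; [|exact: nbrs_finite|by move=> y _; rewrite lee_fin].
rewrite esum_mkcond; apply: eq_esum => y _.
case: ifPn => [/set_mem /= ->|/negP yx]; first by rewrite mul1r.
by case: (boolP (edge G x y)) => [e|_]; [case: yx; exact/mem_set|rewrite mul0r].
Qed.

(** Tonelli for the double series over edges, with the symmetry of [edge]. *)
Lemma adjacency_swap f g : (forall z, 0 <= f z) -> (forall z, 0 <= g z) ->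
  series_of (fun x => f x * A g x) = series_of (fun x => A f x * g x).
Proof.
move=> f0 g0; pose a x y := (f x * ((edge G x y)%:R * g y))%:E.
transitivity (\sum_(x <oo) \sum_(y <oo) a x y)%E.
  apply: eq_eseriesr => x _; rewrite EFinM adjacency_series// -series_ofZ//.
  by move=> y; rewrite mulr_ge0.
rewrite nneseries_interchange; last first.
  by move=> x y; rewrite lee_fin !mulr_ge0.
apply: eq_eseriesr => y _.
rewrite [RHS]EFinM muleC adjacency_series// -series_ofZ//; last first.
  by move=> x; rewrite mulr_ge0.
by apply: eq_eseriesr => x _; rewrite /a edge_sym; congr EFin; lra.
Qed.

(** Swap against the constant [1], on which the operator takes the value [d]. *)
Lemma series_adjacency f : (forall z, 0 <= f z) ->
  series_of (A f) = (d%:R%:E * series_of f)%E.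
Proof.
move=> f0; rewrite -series_ofZ//.
have := @adjacency_swap (fun=> 1) f (fun=> ler01) f0.
rewrite (_ : (fun x => 1 * A f x) = A f); last first.
  by apply/funext => x; rewrite mul1r.
move=> ->; apply: eq_eseriesr => x _; congr (_ * _)%:E.
by rewrite adjacencyE big_const_seq count_predT size_nbrs iter_addr_0.
Qed.

Lemma sqr_sum_le (s : seq nat) psi :
  (\sum_(y <- s) psi y) ^+ 2 <= (size s)%:R * \sum_(y <- s) psi y ^+ 2.
Proof.
elim: s => [|z s IH]; first by rewrite !big_nil expr0n mul0r.
rewrite !big_cons /= -natr1.
set S := \sum_(y <- s) psi y in IH *; set Q := \sum_(y <- s) _ in IH *.
have h : 2 * (psi z * S) <= (size s)%:R * psi z ^+ 2 + Q.
  have : 0 <= \sum_(y <- s) (psi z - psi y) ^+ 2.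
    by apply: sumr_ge0 => y _; rewrite sqr_ge0.
  have -> : \sum_(y <- s) (psi z - psi y) ^+ 2 =
      (size s)%:R * psi z ^+ 2 + Q - 2 * (psi z * S).
    have -> : (size s)%:R * psi z ^+ 2 = \sum_(y <- s) psi z ^+ 2.
      by rewrite big_const_seq count_predT iter_addr_0 mulr_natl.
    rewrite /S /Q !mulr_sumr -big_split /=.
    by rewrite -sumrB; apply: eq_bigr => y _; lra.
  lra.
by rewrite sqrrD; lra.
Qed.

(** Pointwise [(A psi)^2 <= d A (psi^2)], and summing [A] costs another factor [d]. This crude bound
    makes the supremum in [opnorm] finite. *)
Lemma sum_sq_adjacency_le psi :
  (sum_sq (A psi) <= (d%:R ^+ 2)%:E * sum_sq psi)%E.
Proof.
have sq0 x : 0 <= psi x ^+ 2 by rewrite sqr_ge0.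
have AA0 x : 0 <= A (fun x => psi x ^+ 2) x by apply: adjacency_ge0.
apply: (@le_trans _ _ (series_of (fun x => d%:R * A (fun x => psi x ^+ 2) x))).
  apply: le_series_of => x; first by rewrite sqr_ge0.
  by rewrite !adjacencyE -[in X in _ <= X](size_nbrs x) sqr_sum_le.
by rewrite series_ofZ// series_adjacency// muleA.
Qed.

Lemma l2_adjacency psi : l2 psi -> l2 (A psi).
Proof.
move=> /l2P fin; apply/l2P; apply: (le_lt_trans (sum_sq_adjacency_le psi)).
have: (0 <= sum_sq psi)%E by apply: series_of_ge0 => x; rewrite sqr_ge0.
by move: fin; case: (sum_sq psi) => // r _ _; rewrite -EFinM ltry.
Qed.

(** For nonnegative functions this is the swap of series; the general case splits into positive and
    negative parts, which stay square-summable. *)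
Lemma inner_adjacency phi psi : l2 phi -> l2 psi ->
  inner (A phi) psi = inner phi (A psi).
Proof.
move=> lphi lpsi.
have nonneg f g : l2 f -> l2 g -> (forall x, 0 <= f x) -> (forall x, 0 <= g x) ->
    inner (A f) g = inner f (A g).
  move=> lf lg f0 g0; apply: EFin_inj.
  have Af x := adjacency_ge0 x f0; have Ag x := adjacency_ge0 x g0.
  rewrite (inner_series (l2_adjacency lf) lg); last first.
    by move=> x; rewrite mulr_ge0.
  rewrite (inner_series lf (l2_adjacency lg)) ?adjacency_swap// => x.
  by rewrite mulr_ge0.
pose p f x := Num.max (f x) 0.
have p0 f x : 0 <= p f x by rewrite le_max lexx orbT.
have lp f : l2 f -> l2 (p f).
  apply: le_l2 => x; rewrite (ger0_norm (p0 f x)) ge_max.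
  by rewrite normr_ge0 ler_norm.
have pE f : f = p f - p (- f).
  apply/funext => x; change (f x = Num.max (f x) 0 - Num.max (- f x) 0).
  have [h|/ltW h] := leP 0 (f x).
    by rewrite max_r ?subr0// oppr_le0.
  by rewrite max_l ?oppr_ge0// sub0r opprK.
have lN f : l2 f -> l2 (- f) by move=> /(l2Z (-1)); rewrite scaleN1r.
pose a := to_ell2 (lp _ lphi); pose b := to_ell2 (lp _ (lN _ lphi)).
pose a' := to_ell2 (lp _ lpsi); pose b' := to_ell2 (lp _ (lN _ lpsi)).
pose Al (u : ell2 R) := to_ell2 (l2_adjacency (ell2_l2 u)).
have AB (u v : ell2 R) : Al (u - v) = Al u - Al v.
  apply/val_inj; rewrite /= -[in LHS]scaleN1r [in LHS]addrC adjacency_linear.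
  by rewrite scaleN1r addrC.
have key (u v : ell2 R) : (forall x, 0 <= u x) -> (forall x, 0 <= v x) ->
    inner (Al u) v = inner u (Al v).
  by apply: nonneg; exact: ell2_l2.
have phiE : phi = (a - b : ell2 R) by exact: pE.
have psiE : psi = (a' - b' : ell2 R) by exact: pE.
rewrite phiE psiE.
change (inner (Al (a - b)) (a' - b' : ell2 R) =
        inner (a - b : ell2 R) (Al (a' - b'))).
have IP := inner_psd R.
rewrite !AB !(psdBl IP) !(psdBr IP) !key//; exact: p0.
Qed.

End Adjacency.

(** * Nets lower the spectral radius *)

Lemma bernoulli_le (R : realFieldType) (x : R) n : x <= 1 ->
  1 - n%:R * x <= (1 - x) ^+ n.
Proof.
move=> x1; elim: n => [|n IH]; first by rewrite mul0r subr0 expr0.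
have x1' : 0 <= 1 - x by lra.
have := ler_wpM2l x1' IH; rewrite exprS; apply: le_trans.
have : 0 <= n%:R * x ^+ 2 by rewrite mulr_ge0 ?sqr_ge0.
by rewrite -natr1; lra.
Qed.

Section OperatorNorm.
Variables (R : realType) (d : nat) (G : regular_graph d) (rho : R).

Local Notation A := (adjacency G : (nat -> R) -> nat -> R).

Lemma inner_adjacency_crude (psi : nat -> R) : l2 psi ->
  inner (A psi) (A psi) <= d%:R ^+ 2 * inner psi psi.
Proof.
move=> h; rewrite -lee_fin EFinM !inner_normE//; last exact: l2_adjacency.
exact: sum_sq_adjacency_le.
Qed.

Hypothesis normA : opnorm A = rho.

Lemma opnorm_ub (f : nat -> R) : l2 f -> l2norm f <= 1 -> l2norm (A f) <= rho.
Proof.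
move=> lf nf; rewrite -normA; apply: ub_le_sup; last by exists f.
(* The set must be bounded above for [sup] to be an upper bound; the crude norm bound [d] shows
   it. *)
exists d%:R => _ [g [lg ng] <-].
rewrite -[leRHS]ger0_norm// -sqrtr_sqr ler_sqrt ?sqr_ge0//.
apply: (le_trans (inner_adjacency_crude lg)).
by rewrite ler_piMr ?sqr_ge0// -ler_sqrt// sqrtr1.
Qed.

Lemma opnorm_ge0 : 0 <= rho.
Proof.
have l0 : l2 (0 : nat -> R) by exact: (ell2_l2 (0 : ell2 R)).
apply: (le_trans (sqrtr_ge0 _) (opnorm_ub l0 _)).
rewrite /l2norm; have := psdZl (inner_psd R) 0 (0 : ell2 R) 0.
by rewrite scaler0 mul0r => /= ->; rewrite sqrtr0.
Qed.

Lemma opnorm_le (psi : nat -> R) : l2 psi ->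
  inner (A psi) (A psi) <= rho ^+ 2 * inner psi psi.
Proof.
move=> lpsi; have IP := inner_psd R.
pose u := to_ell2 lpsi; pose Au := to_ell2 (l2_adjacency G lpsi).
have : 0 <= inner psi psi := psd_ge0 IP u.
rewrite le_eqVlt => /orP[/eqP n0|n0].
  (* A vector of norm zero cannot be normalised; the crude bound settles it. *)
  by have := inner_adjacency_crude lpsi; rewrite -n0 !mulr0.
pose c := (l2norm psi)^-1.
have c0 : 0 < c by rewrite invr_gt0 sqrtr_gt0.
have c2 : c ^+ 2 * inner psi psi = 1.
  by rewrite exprVn sqr_sqrtr ?ltW// mulVf ?gt_eqF.
have lc := l2Z c lpsi.
have ncu : inner (c *: psi) (c *: psi) = 1.
  change (inner (c *: u) (c *: u : ell2 R) = 1).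
  by rewrite (psdZl IP) (psdZr IP) mulrA -expr2.
have Ac : A (c *: psi) = c *: A psi.
  have := adjacency_linear G c psi 0; rewrite addr0 => ->.
  have := adjacency_linear G 1 0 (0 : nat -> R).
  rewrite scale1r addr0 scale1r => /eqP; rewrite -subr_eq subrr => /eqP <-.
  by rewrite addr0.
have : l2norm (A (c *: psi)) <= rho.
  by apply: opnorm_ub => //; rewrite /l2norm ncu sqrtr1.
rewrite /l2norm Ac.
have nAc : inner (c *: A psi) (c *: A psi) = c ^+ 2 * inner (A psi) (A psi).
  change (inner (c *: Au) (c *: Au : ell2 R) = c ^+ 2 * inner (A psi) (A psi)).
  by rewrite (psdZl IP) (psdZr IP) mulrA -expr2.
rewrite -(ler_sqr (sqrtr_ge0 _) opnorm_ge0) sqr_sqrtr; last first.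
  by rewrite nAc mulr_ge0 ?sqr_ge0//; exact: (psd_ge0 IP Au).
rewrite nAc => h; rewrite -[leLHS]mulr1 -c2 mulrA [_ * c ^+ 2]mulrC.
by rewrite ler_wpM2r// ltW.
Qed.

End OperatorNorm.

Section L2Operators.
Variables (R : realType) (d : nat) (G : regular_graph d).
Implicit Types (S : pred nat) (u v : ell2 R).

Definition restr S (psi : nat -> R) : nat -> R :=
  fun x => if S x then psi x else 0.

Lemma l2_restr S psi : l2 psi -> l2 (restr S psi).
Proof. by apply: le_l2 => x; rewrite /restr; case: ifP; rewrite ?normr0. Qed.

Definition restr2 S u : ell2 R := to_ell2 (l2_restr S (ell2_l2 u)).

Definition adjacency2 u : ell2 R := to_ell2 (l2_adjacency G (ell2_l2 u)).

Local Notation ip := (fun u v : ell2 R => inner u v).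

Lemma restr_adjoint S : adjoint ip (restr2 S) (restr2 S).
Proof.
move=> u v; apply: eq_Rintegral => x _ /=; rewrite /restr.
by case: ifP; rewrite ?mul0r ?mulr0.
Qed.

Lemma restr_idem S u : restr2 S (restr2 S u) = restr2 S u.
Proof.
by apply/val_inj/funext => x /=; rewrite /restr; case: ifP => // ->.
Qed.

Lemma restrC S u : u - restr2 S u = restr2 (predC S) u.
Proof.
apply/val_inj/funext => x.
change (u x - restr S u x = restr (predC S) u x).
by rewrite /restr /=; case: ifP => _; rewrite ?subrr ?subr0.
Qed.

Lemma adjacency_adjoint : adjoint ip adjacency2 adjacency2.
Proof. by move=> u v; apply: inner_adjacency; exact: ell2_l2. Qed.

Lemma iter_adjacency2 k u : iter k adjacency2 u = iter k (adjacency G) u :> (nat -> R).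
Proof. by elim: k => //= k ->. Qed.

End L2Operators.

(** * Walks that avoid a net *)

Section Nets.
Variables (R : realType) (d : nat) (G : regular_graph d).
Implicit Types (S : pred nat) (k x y : nat).

(** The [k]-neighbourhood of [S], as a boolean recursion whose value at [x] reads [S] only within
    distance [k] of [x]. *)
Fixpoint reach S k : pred nat :=
  if k is k'.+1 then fun x => reach S k' x || has (reach S k') (nbrs G x) else S.

Lemma reach_sub S S' k x : subpred S S' -> reach S k x -> reach S' k x.
Proof.
move=> sub; elim: k x => [|k IH] x /=; first exact: sub.
move=> /orP[/IH-> //|/hasP[y yx /IH h]].
by apply/orP; right; apply/hasP; exists y.
Qed.

(** Adding the vertices that [w] leaves uncovered yields a net for every [w], at a small cost in
    density when [w] is random. *)
Definition cover_set (w : pred nat) r : pred nat := fun x => w x || ~~ reach w r x.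

Lemma reach_mono S k x : S x -> reach S k x.
Proof. by move=> Sx; elim: k => //= k ->. Qed.

Lemma cover_set_net (w : pred nat) r x : reach (cover_set w r) r x.
Proof.
have [h|h] := boolP (reach w r x); last by apply: reach_mono; rewrite /cover_set h orbT.
by apply: reach_sub h => y; rewrite /cover_set => ->.
Qed.

Hypothesis d_gt0 : (0 < d)%N.
Variables (S : pred nat).
Implicit Types (f g : nat -> R).

Local Notation A := (adjacency G : (nat -> R) -> nat -> R).
Local Notation Q := (restr (predC S) : (nat -> R) -> nat -> R).
Local Notation N f := (Q (A (Q f))).

Let has_nbr x : exists y, edge G x y.
Proof.
have := size_nbrs G x; case E : (nbrs G x : seq nat) => [|y s] /=.
  by move=> /eqP; rewrite eq_sym -leqn0 leqNgt d_gt0.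
move=> _; exists y; rewrite -in_nbrs.
by have : y \in (nbrs G x : seq nat) by rewrite E mem_head.
Qed.

(** The walk that steps to a neighbour and back contributes [f x]. *)
Lemma adjacency2_ge f x : (forall y, 0 <= f y) -> f x <= A (A f) x.
Proof.
move=> f0; have [y xy] := has_nbr x.
apply: (@le_trans _ _ (A f y)); last first.
  by apply: le_adjacency_term => // z; apply: adjacency_ge0.
by apply: le_adjacency_term => //; rewrite edge_sym.
Qed.

Let Q_le f x : (forall y, 0 <= f y) -> 0 <= Q f x <= f x.
Proof. by move=> f0; rewrite /restr; case: ifP; rewrite ?lexx ?f0. Qed.

Let N_le f g x : (forall y, 0 <= f y) -> (forall y, f y <= g y) ->
  0 <= N f x <= A g x.
Proof.
move=> f0 fg.
have Af y : 0 <= A (Q f) y.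
  by apply: adjacency_ge0 => z; case/andP: (Q_le z f0).
have /andP[-> h] := Q_le x Af; rewrite (le_trans h)//=.
apply: le_adjacency => y; case/andP: (Q_le y f0) => _ h'.
exact: le_trans h' _.
Qed.

Let N_mono f g x : (forall y, f y <= g y) -> N f x <= N g x.
Proof.
move=> fg; rewrite {1 3}/restr; case: ifP => // _.
by apply: le_adjacency => y; rewrite /restr; case: ifP.
Qed.

Let iterN_ge0 k f x : (forall y, 0 <= f y) -> 0 <= iter k (fun f => N f) f x.
Proof.
move=> f0; elim: k x => [|k IH] x //; rewrite iterS.
by have /andP[] := N_le x IH (fun y => lexx _).
Qed.

Let iterN_mono k f g x : (forall y, f y <= g y) ->
  iter k (fun f => N f) f x <= iter k (fun f => N f) g x.
Proof. by move=> fg; elim: k x => [|k IH] x //; rewrite !iterS N_mono. Qed.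

(* For [f = \1_[set y]] this counts the walks of length [2k] from [x] to [y]
   that visit [S]; a walk to [S] and back shows that it is positive at [y = x]
   when [S] is within distance [k]. *)
Let defect k f x :=
  iter (k + k) A f x - iter (k + k) (fun f => N f) (Q f) x.

Let adjacencyB f g x : A (fun y => f y - g y) x = A f x - A g x.
Proof. by rewrite !adjacencyE sumrB. Qed.

(** Two steps are prepended to a walk of length [2k] that visits [S]. *)
Let defectS1 k f x : (forall y, 0 <= f y) ->
  A (A (defect k f)) x <= defect k.+1 f x.
Proof.
move=> f0; rewrite /defect addSn addnS !iterS.
set F := iter _ _ f; set H := iter _ _ (Q f).
rewrite (_ : A (fun x => F x - H x) = fun x => A F x - A H x); last first.
  by apply/funext => y; rewrite adjacencyB.
rewrite adjacencyB lerD2l lerN2.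
have H0 y : 0 <= H y by apply: iterN_ge0 => z; case/andP: (Q_le z f0).
have NH y : 0 <= N H y <= A H y by apply: N_le.
suff /andP[] : 0 <= N (N H) x <= A (A H) x by [].
by apply: N_le => y; case/andP: (NH y).
Qed.

(** One step is added at each end, which lets a closed walk at a neighbour of [x] extend to one at
    [x]. *)
Let defectS2 k f x : (forall y, 0 <= f y) ->
  A (defect k (A f)) x <= defect k.+1 f x.
Proof.
move=> f0; rewrite /defect adjacencyB addSn addnS !(iterS (k + k).+1) !iterSr.
rewrite lerD2l lerN2; set H := iter _ _ (N (Q f)).
have Qf y : 0 <= Q f y <= f y by apply: Q_le.
have H0 y : 0 <= H y.
  apply: iterN_ge0 => z.
  by have /andP[] := @N_le _ (Q f) z (fun y => proj1 (andP (Qf y))) (fun=> lexx _).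
suff /andP[] : 0 <= N H x <= A (iter (k + k) (fun f => N f) (Q (A f))) x by [].
apply: N_le => // y; apply: iterN_mono => z.
rewrite {1 4}/restr; case: ifP => // _; apply: le_adjacency => t.
rewrite /restr; case: ifP => // _; case: ifP => //.
Qed.

(** Induction on [k]. If [x] reaches [S] within [k], its closed walk is lengthened by a step to and
    fro; otherwise a neighbour does, and its closed walk is extended to [x] at both ends. *)
Lemma net_defect k f x : (forall y, 0 <= f y) ->
  (reach S k x)%:R * f x <= defect k f x.
Proof.
elim: k f x => [|k IH] f x f0.
  by rewrite /defect /= /restr /=; case: (S x); rewrite /= ?mul1r ?mul0r ?subr0 ?subrr.
have D0 g y : (forall y, 0 <= g y) -> 0 <= defect k g y.
  by move=> g0; apply: le_trans (IH g y g0); rewrite mulr_ge0.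
have Af y : 0 <= A f y by apply: adjacency_ge0.
rewrite /=; have [h|_] := boolP (reach S k x).
  apply: le_trans (defectS1 k x f0).
  apply: (@le_trans _ _ (defect k f x)); first by have := IH f x f0; rewrite h.
  by apply: adjacency2_ge => y; apply: D0.
apply: le_trans (defectS2 k x f0); rewrite /=.
case: hasP => [[y yx ny]|_]; last first.
  by rewrite mul0r; apply: adjacency_ge0 => y; apply: D0.
rewrite in_nbrs in yx; rewrite mul1r.
apply: (@le_trans _ _ (defect k (A f) y)); last first.
  by apply: le_adjacency_term => // z; apply: D0.
have := IH _ y Af; rewrite ny mul1r; apply: le_trans.
by apply: le_adjacency_term => //; rewrite edge_sym.
Qed.

End Nets.

(** * The quantitative gap off a net *)

Section NetGap.
Variables (R : realType) (d : nat) (G : regular_graph d) (rho : R) (r : nat).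
Hypothesis d_gt0 : (0 < d)%N.
Hypothesis normA : opnorm (adjacency (R := R) G) = rho.
Hypothesis rho_ge1 : 1 <= rho.
Hypothesis r_gt0 : (0 < r)%N.
Variable S : pred nat.
Hypothesis netS : forall x, reach G S r x.

Local Notation A := (adjacency G : (nat -> R) -> nat -> R).
Local Notation A2 := (@adjacency2 R d G).
Local Notation Q2 := (@restr2 R (predC S)).
Local Notation ip := (fun u v : ell2 R => inner u v).
Local Notation IP := (inner_psd R).

(** Its product with [2r] is [rho^(-2r)], so Bernoulli's inequality gives [(rho (1 -
    net_gap_width))^(2r) >= rho^(2r) - 1]. *)
Definition net_gap_width : R := (rho ^+ (r + r))^-1 / (r + r)%:R.

Let N2 u := Q2 (A2 (Q2 u)).

Let N2_adjoint : adjoint ip N2 N2.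
Proof.
have Qa := @restr_adjoint R (predC S); have Aa := @adjacency_adjoint R d G.
exact: adjoint_comp Qa (adjoint_comp Aa Qa).
Qed.

Lemma iter_adjacency2_norm k (u : ell2 R) :
  inner (iter k A2 u) (iter k A2 u) <= rho ^+ (k + k) * inner u u.
Proof.
elim: k => [|k IH]; first by rewrite expr0 mul1r.
rewrite iterS addSn addnS !exprS mulrA -mulrA -expr2.
apply: le_trans (opnorm_le normA (ell2_l2 _)) _.
by rewrite ler_wpM2l ?sqr_ge0.
Qed.

Let iterN2E k u :
  iter k N2 u = iter k (fun f => restr (predC S) (A (restr (predC S) f))) u
    :> (nat -> R).
Proof. by elim: k => //= k ->. Qed.

(** Passing to [|u|] keeps the norm and only enlarges the iterates of the nonnegative kernel [N2].
    Then [N2^(2r) <= A^(2r) - 1] by [net_defect], as every vertex is within [r] of [S]. *)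
Lemma iter_net_norm (u : ell2 R) : Q2 u = u ->
  inner (iter r N2 u) (iter r N2 u) <= (rho ^+ (r + r) - 1) * inner u u.
Proof.
move=> Qu.
have lw : l2 (fun x => `|u x|).
  by apply: le_l2 (ell2_l2 u) => x; rewrite normr_id.
have [w wE] : exists w : ell2 R, forall x, w x = `|u x| by exists (to_ell2 lw).
have nw : inner u u = inner w w.
  apply: eq_Rintegral => x _ /=.
  by rewrite wE -!expr2 real_normK ?num_real.
have w0 x : 0 <= w x by rewrite wE.
have Qw : Q2 w = w.
  apply/val_inj/funext => x; rewrite /= /restr; case: ifPn => // Sx.
  have := congr1 (fun v : ell2 R => v x) Qu.
  by rewrite /= /restr (negbTE Sx) wE => <-; rewrite normr0.
have N2_abs k x : `|iter k N2 u x| <= iter k N2 w x.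
  elim: k x => [|k IH] x; first by rewrite /= wE.
  rewrite /= /restr; case: ifP => _; last by rewrite normr0.
  apply: le_trans (adjacency_norm_le _ _ _) _; apply: le_adjacency => y.
  by case: ifP => _; rewrite ?normr0.
have -> : (rho ^+ (r + r) - 1) * inner u u =
    rho ^+ (r + r) * inner w w - inner w w by rewrite nw; lra.
apply: (@le_trans _ _ (inner (iter r N2 w) (iter r N2 w))).
  apply: le_inner; try exact: ell2_l2.
  move=> x; apply: (le_trans (ler_norm _)); rewrite normrM.
  by apply: ler_pM.
have /= -> := adjoint_iter r N2_adjoint w (iter r N2 w).
rewrite -iterD.
apply: le_trans (lerB (iter_adjacency2_norm r w) (lexx _)).
have /= -> := adjoint_iter r (@adjacency_adjoint R d G) w (iter r A2 w).
have /= <- := psdBr IP w (iter r A2 (iter r A2 w)) w.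
apply: (@le_inner R w w (iter (r + r) N2 w)
  (iter r A2 (iter r A2 w) - w : ell2 R)); try exact: ell2_l2.
move=> x; rewrite ler_wpM2l//.
rewrite -iterD; change (iter (r + r) N2 w x <= iter (r + r) A2 w x - w x).
rewrite iterN2E iter_adjacency2 lerBrDr -lerBrDl.
have Qw' : restr (predC S) w = w by rewrite -{2}Qw.
by have := net_defect G d_gt0 S r x w0; rewrite netS mul1r Qw'.
Qed.

Lemma net_gap_width_gt0 : 0 < net_gap_width.
Proof.
rewrite /net_gap_width divr_gt0 ?invr_gt0 ?exprn_gt0 ?ltr0n ?addn_gt0 ?r_gt0//.
exact: lt_le_trans ltr01 _.
Qed.

Lemma net_gap_width_le1 : net_gap_width <= 1.
Proof.
rewrite ler_pdivrMr ?mul1r ?ltr0n ?addn_gt0 ?r_gt0//.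
have p0 : 0 < rho ^+ (r + r) by rewrite exprn_gt0// (lt_le_trans ltr01).
apply: (@le_trans _ _ 1); first by rewrite invf_le1 ?exprn_ege1.
by rewrite ler1n addn_gt0 r_gt0.
Qed.

(** Let [c = rho (1 - net_gap_width)]. The numbers [||N2^k u||^2] are log-convex; a first ratio
    above [c^2] would make the [r]-th exceed [c^(2r) ||u||^2], against [iter_net_norm].
    Cauchy-Schwarz passes from the norm of [N2 u] to the form. *)
Lemma net_gap (u : ell2 R) : Q2 u = u ->
  inner u (A2 u) <= rho * (1 - net_gap_width) * inner u u.
Proof.
move=> Qu; pose a k := inner (iter k N2 u) (iter k N2 u).
have a_ge0 k : 0 <= a k by exact: (psd_ge0 IP).
have a_convex k : a k.+1 ^+ 2 <= a k * a k.+2.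
  have := psd_CauchySchwarz IP (iter k N2 u) (iter k.+2 N2 u).
  have /= := N2_adjoint (iter k N2 u) (iter k.+1 N2 u).
  by rewrite /a !iterS => ->.
have rho0 := lt_le_trans ltr01 rho_ge1.
pose c := rho * (1 - net_gap_width).
have c0 : 0 <= c by rewrite mulr_ge0 ?(ltW rho0)// subr_ge0 net_gap_width_le1.
have c_pow : rho ^+ (r + r) - 1 <= (c ^+ 2) ^+ r.
  rewrite -exprM mul2n -addnn exprMn.
  have := bernoulli_le (r + r) net_gap_width_le1.
  have -> : (r + r)%:R * net_gap_width = (rho ^+ (r + r))^-1.
    by rewrite /net_gap_width mulrC divfK// pnatr_eq0 -lt0n addn_gt0 r_gt0.
  have p0 : 0 < rho ^+ (r + r) by rewrite exprn_gt0.
  move=> /(ler_wpM2l (ltW p0)); apply: le_trans.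
  by rewrite mulrBr mulr1 divff ?gt_eqF.
have a1 : a 1%N <= c ^+ 2 * a 0%N.
  rewrite leNgt; apply/negP => lt.
  (* Index [r - 1] is taken because the strict growth is from one index to the next, here up to
     [r]. *)
  have [g1 g2] := log_convex_growth a_ge0 a_convex r.-1 (sqr_ge0 c) lt.
  have := iter_net_norm Qu; rewrite leNgt => /negP; apply.
  rewrite -{3 4}(prednK r_gt0); apply: le_lt_trans g1.
  apply: le_trans (ler_wpM2l (sqr_ge0 c) g2).
  rewrite mulrA -exprS prednK//.
by apply: ler_wpM2r c_pow; exact: (a_ge0 0%N).
have -> : inner u (A2 u) = inner u (N2 u).
  by rewrite /N2 -{1}Qu (restr_adjoint _ u) Qu.
have : inner u (N2 u) ^+ 2 <= (c * inner u u) ^+ 2.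
  apply: le_trans (psd_CauchySchwarz IP u (N2 u)) _.
  rewrite exprMn mulrC [inner u u ^+ 2]expr2 mulrA.
  by rewrite ler_wpM2r ?(psd_ge0 IP).
have cu : 0 <= c * inner u u by rewrite mulr_ge0 ?(psd_ge0 IP).
have [n0|n0] := leP (inner u (N2 u)) 0; first by move=> _; apply: le_trans cu.
by rewrite ler_sqr ?nnegrE// ltW.
Qed.

End NetGap.

(** * Spectral projections *)

Section SpectralProjection.
Variables (R : realType) (d : nat) (G : regular_graph d).
Variable P : set R -> (nat -> R) -> nat -> R.
Hypothesis PP : spectral_projections (adjacency G) P.

Local Notation A2 := (@adjacency2 R d G).
Local Notation IP := (ip2_psd R).

Lemma projection_l2 E (u : ell2 R) : measurable E -> l2 (P E u).
Proof. by case: PP => + _ _ _ mE => /(_ E mE)[h _ _ _]; apply/h/ell2_l2. Qed.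

Definition projection2 E (mE : measurable E) u : ell2 R :=
  to_ell2 (projection_l2 u mE).

Lemma projection_adjoint E (mE : measurable E) :
  adjoint (@ip2 R) (projection2 mE) (projection2 mE).
Proof.
move=> u v; case: PP => + _ _ _ => /(_ E mE)[_ _ _ h].
by apply: h; exact: ell2_l2.
Qed.

Lemma projection_idem E (mE : measurable E) u :
  projection2 mE (projection2 mE u) = projection2 mE u.
Proof.
case: PP => + _ _ _ => /(_ E mE)[_ _ h _].
by apply/val_inj; rewrite /= h//; exact: ell2_l2.
Qed.

Lemma projection_norm E (mE : measurable E) u :
  ip2 (projection2 mE u) (projection2 mE u) = ip2 u (projection2 mE u).
Proof.
transitivity (ip2 u (projection2 mE (projection2 mE u))).
  exact: projection_adjoint.
by rewrite projection_idem.
Qed.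

Lemma projectionD E (mE : measurable E) u v :
  projection2 mE (u + v) = projection2 mE u + projection2 mE v.
Proof.
case: PP => + _ _ _ => /(_ E mE)[_ h _ _].
apply/val_inj => /=; have := h 1 u v (ell2_l2 u) (ell2_l2 v).
by rewrite !scale1r.
Qed.

Lemma projectionN E (mE : measurable E) u :
  projection2 mE (- u) = - projection2 mE u.
Proof.
have h := projectionD mE; apply/eqP; rewrite -addr_eq0 -h addNr.
apply/eqP/(addrI (projection2 mE 0)).
by rewrite -h !addr0.
Qed.

Lemma ip2_eq0 (u : ell2 R) : ip2 u u = 0 -> u = 0.
Proof.
move=> h; apply/val_inj/funext => x.
have : u x ^+ 2 <= ip2 u u := sqr_le_inner x (ell2_l2 u).
rewrite h => ?; suff : u x ^+ 2 == 0 by rewrite sqrf_eq0 => /eqP.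
by rewrite eq_le sqr_ge0 andbT.
Qed.

Lemma spectral_measure u : exists m : {measure set R -> \bar R},
  [/\ forall E (mE : measurable E),
        m E = (ip2 (projection2 mE u) (projection2 mE u))%:E,
      m setT = (ip2 u u)%:E,
      m.-integrable setT (fun x : R => x%:E) &
      ((ip2 u (A2 u))%:E = \int[m]_x x%:E)%E].
Proof.
case: PP => _ PT _ /(_ u (ell2_l2 u))[m [mE mi mA]].
exists m; split=> //; first by move=> E mE'; rewrite projection_norm mE.
by rewrite mE// PT//; exact: ell2_l2.
Qed.

Lemma projection_split E F (mE : measurable E) (mF : measurable F)
    (mEF : measurable (F `&` E)) (mFE : measurable (F `\` E)) u :
  ip2 (projection2 mF u) (projection2 mF u) =
  ip2 (projection2 mEF u) (projection2 mEF u) +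
  ip2 (projection2 mFE u) (projection2 mFE u).
Proof.
have [m [mP _ _ _]] := spectral_measure u.
apply: EFin_inj; rewrite [RHS]EFinD -(mP _ mF) -(mP _ mEF) -(mP _ mFE).
by rewrite (measureDI _ mF (A := F) (B := E))// addeC.
Qed.

(** [E] already carries the whole spectral mass of [u], which leaves none for a disjoint set. *)
Lemma projection_disjoint E F (mE : measurable E) (mF : measurable F) u :
  F `&` E = set0 -> projection2 mE u = u -> projection2 mF u = 0.
Proof.
move=> FE Eu; apply: ip2_eq0.
have [m [mP mT _ _]] := spectral_measure u.
have : (m F + m E <= m setT)%E.
  rewrite -measureU//; apply: le_measure; rewrite ?inE//.
  exact: measurableU.
rewrite mT !mP Eu -[X in (X <= _)%E]EFinD lee_fin; have := psd_ge0 IP (projection2 mF u).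
by lra.
Qed.

Lemma projection_sub E F (mE : measurable E) (mF : measurable F) u :
  F `<=` E -> projection2 mE u = 0 -> projection2 mF u = 0.
Proof.
move=> FE Eu; apply: ip2_eq0.
have [m [mP mT _ _]] := spectral_measure u.
have : (m F <= m E)%E by apply: le_measure; rewrite ?inE.
rewrite !mP Eu lee_fin; have := psd_ge0 IP (projection2 mF u).
have := psdZl IP 0 (0 : ell2 R) 0; rewrite scale0r mul0r => ->; lra.
Qed.

(** The definition of [spectral_projections] speaks of quadratic forms only, so invariance comes
    from polarisation. Inside [E] only [u] contributes to the spectral measure of [u + v] or
    [u - v], outside only [v] up to sign. The two measures agree, hence so do the two forms, and
    their difference is [4 <u, A v>]. *)
Lemma projection_invariant E (mE : measurable E) u v :
  projection2 mE u = u -> projection2 mE v = 0 -> ip2 u (A2 v) = 0.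
Proof.
move=> Eu Ev.
have [m [mP _ _ mA]] := spectral_measure (u + v).
have [m' [mP' _ _ mA']] := spectral_measure (u - v).
have mm F : measurable F -> m F = m' F.
  move=> mF; rewrite mP mP'; congr EFin.
  have mEF : measurable (F `&` E) by exact: measurableI.
  have mFE : measurable (F `\` E) by exact: measurableD.
  rewrite !(projection_split mE mF mEF mFE) !(projectionD, projectionN).
  have -> : projection2 mEF v = 0 by exact: projection_sub Ev.
  have -> : projection2 mFE u = 0.
    by apply: projection_disjoint Eu; rewrite setDE -setIA setICl setI0.
  rewrite oppr0 !addr0 !add0r; congr (_ + _).
  have NN (w : ell2 R) : ip2 (- w) (- w : ell2 R) = ip2 w w.
    by rewrite -(scaleN1r w) (psdZl IP) (psdZr IP) !mulN1r opprK.
  by rewrite NN.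
have : ip2 (u + v) (A2 (u + v)) = ip2 (u - v) (A2 (u - v)).
  apply: EFin_inj; rewrite mA mA'; apply: eq_measure_integral => F mF _.
  exact: mm.
have AD (w w' : ell2 R) : A2 (w + w') = A2 w + A2 w'.
  apply/val_inj => /=; have := adjacency_linear G 1 w w'.
  by rewrite !scale1r.
have AN (w : ell2 R) : A2 (- w) = - A2 w.
  by apply/eqP; rewrite -addr_eq0 -AD addNr; apply/eqP/(addrI (A2 0));
    rewrite -AD !addr0.
rewrite AD AD AN !(psdBl IP) !(psdBr IP) !(psdDl IP) !(psdDr IP).
have := psdC IP v (A2 u); have : ip2 (A2 u) v = ip2 u (A2 v).
  exact: adjacency_adjoint.
by lra.
Qed.

(** The spectral measure of [u] is carried by [E], where the integrand is at least [a]. *)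
Lemma projection_form_ge (a : R) E (mE : measurable E) u :
  (forall x, E x -> a <= x) ->
  projection2 mE u = u -> a * ip2 u u <= ip2 u (A2 u).
Proof.
move=> aE Pu; have [m [mP mT mi mA]] := spectral_measure u.
have mEu : m E = (ip2 u u)%:E by rewrite mP Pu.
have mCE : measurable (~` E) by exact: measurableC.
have mC0 : m (~` E) = 0%E.
  have : m (~` E `|` E) = (m (~` E) + m E)%E := measureU m mCE mE (setICl E).
  rewrite setUC setUv mT mEu; case: (m (~` E)) => //= t [] h; congr EFin; lra.
rewrite -lee_fin mA (negligible_integral mCE _ mi mC0)//.
rewrite setTD setCK EFinM -mEu -integral_cst//.
apply: le_integral => //.
- apply/integrableP; split=> //; rewrite integral_cst// mEu.
  by rewrite -EFinM ltry.
- exact: integrableS mi.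
- by move=> x /set_mem Ex; rewrite lee_fin aE.
Qed.

(** Since [A (P u)] is orthogonal to [u - P u], pairing [P (Z u)] with [P u] gives the form of [Z]
    at [P u], at least [(1 - theta / 2) ||P u||^2]; Cauchy-Schwarz concludes. The bound [theta <= 2]
    permits squaring. *)
Lemma projection_lazy (rho theta : R) (mE : measurable `[rho * (1 - theta), rho]) u :
  0 < rho -> theta <= 2 ->
  (1 - theta / 2) ^+ 2 * ip2 (projection2 mE u) (projection2 mE u) <=
  ip2 (projection2 mE (lazy (fun v => rho^-1 *: A2 v) u))
        (projection2 mE (lazy (fun v => rho^-1 *: A2 v) u)).
Proof.
move=> rho0 theta2; set Z := lazy _ u; set Pu := projection2 mE u.
have PPu : projection2 mE Pu = Pu by exact: projection_idem.
have PQu : projection2 mE (u - Pu) = 0.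
  by rewrite projectionD projectionN PPu subrr.
have A2_sym : adjoint (@ip2 R) A2 A2 by exact: adjacency_adjoint.
have Q0 : ip2 (u - Pu) (A2 Pu) = 0.
  by rewrite (psdC IP) A2_sym; exact: projection_invariant PPu PQu.
have form : ip2 (projection2 mE Z) Pu =
    2^-1 * (ip2 Pu Pu + rho^-1 * ip2 Pu (A2 Pu)).
  rewrite projection_adjoint PPu /Z /lazy (psdZl IP) (psdDl IP) (psdZl IP).
  rewrite A2_sym -projection_norm -/Pu.
  by rewrite (psdBl IP) in Q0; rewrite (subr0_eq Q0).
have low : rho * (1 - theta) * ip2 Pu Pu <= ip2 Pu (A2 Pu).
  by apply: projection_form_ge PPu => x; rewrite /= in_itv/= => /andP[].
have CS := psd_CauchySchwarz IP (projection2 mE Z) Pu.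
have N0 := psd_ge0 IP Pu.
have x_ge : (1 - theta / 2) * ip2 Pu Pu <= ip2 (projection2 mE Z) Pu.
  have : (1 - theta) * ip2 Pu Pu <= rho^-1 * ip2 Pu (A2 Pu).
    by rewrite ler_pdivlMl// mulrA.
  by rewrite form; lra.
have t0 : 0 <= 1 - theta / 2 by lra.
move: N0; rewrite le_eqVlt => /orP[/eqP n0|n0].
  by rewrite -n0 mulr0 (psd_ge0 IP).
rewrite -(ler_pM2r n0); apply: le_trans CS.
rewrite -mulrA -expr2 -exprMn ler_sqr ?nnegrE//.
  by rewrite mulr_ge0// ltW.
by apply: le_trans x_ge; rewrite mulr_ge0// ltW.
Qed.

End SpectralProjection.

(** * Local kernels *)

Section Kernels.
Variables (R : realType) (d : nat) (G : regular_graph d) (rho : R) (n : nat).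
Variable S : pred nat.
Implicit Types (f : nat -> R) (u v : ell2 R).

(** Acts on arbitrary functions, so that locality can be stated pointwise; on [ell2] it is
    [lazy T2]. *)
Definition walkop : (nat -> R) -> nat -> R :=
  lazy (fun f => rho^-1 *: adjacency G f).
Definition trace_to f := restr S (iter n walkop f).
Definition trace_from f := iter n walkop (restr S f).
(* [trace_to] and [trace_from] are mutually adjoint, as are [kern i] and
   [kernT i]. *)
Definition kern i f := trace_to (iter i (deflate trace_to trace_from) f).
Definition kernT i f := iter i (deflate trace_to trace_from) (trace_from f).

Local Notation A2 := (@adjacency2 R d G).
Local Notation ip2 := (@ip2 R).
Local Notation IP := (ip2_psd R).

Let T2 u : ell2 R := rho^-1 *: A2 u.
Let B2 := @restr2 R S.
Let F2 := B2 \o iter n (lazy T2).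
Let G2 := iter n (lazy T2) \o B2.
Let kern2 i u := F2 (iter i (deflate F2 G2) u).
Let kernT2 i u := iter i (deflate F2 G2) (G2 u).

Let iter_val m (f2 : ell2 R -> ell2 R) (f : (nat -> R) -> nat -> R) u :
  (forall v, f2 v = f v :> (nat -> R)) -> iter m f2 u = iter m f u :> (nat -> R).
Proof. by move=> h; elim: m => //= m <-; rewrite h. Qed.

Let F2E u : F2 u = trace_to u :> (nat -> R).
Proof.
change (restr S (iter n (lazy T2) u : ell2 R) = trace_to u).
by rewrite (@iter_val n (lazy T2) walkop).
Qed.

Let G2E u : G2 u = trace_from u :> (nat -> R).
Proof. exact: (@iter_val n (lazy T2) walkop (B2 u)). Qed.

Let deflateE u : deflate F2 G2 u = deflate trace_to trace_from u :> (nat -> R).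
Proof.
by rewrite {2}/deflate -F2E -G2E.
Qed.

Lemma kern2E i u : kern2 i u = kern i u :> (nat -> R).
Proof. by rewrite /kern2 /kern F2E (iter_val _ _ deflateE). Qed.

Lemma kernT2E i u : kernT2 i u = kernT i u :> (nat -> R).
Proof. by rewrite /kernT2 /kernT (iter_val _ _ deflateE) G2E. Qed.

Lemma T2_sym : adjoint ip2 T2 T2.
Proof.
move=> u v; rewrite /T2 (psdZl IP) (psdZr IP); congr (_ * _).
exact: adjacency_adjoint.
Qed.

Let B2_sym : adjoint ip2 B2 B2.
Proof. exact: restr_adjoint. Qed.

Let Z2_sym : adjoint ip2 (lazy T2) (lazy T2).
Proof. exact: (lazy_sym IP T2_sym). Qed.

Let FG2 : adjoint ip2 F2 G2.
Proof. by apply: adjoint_comp => //; apply: adjoint_iter. Qed.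

Lemma kern_adjoint i : adjoint ip2 (kern2 i) (kernT2 i).
Proof.
move=> u v; rewrite /kern2 /kernT2 FG2.
by rewrite (adjoint_iter i (deflate_sym IP FG2)).
Qed.

Definition delta x : ell2 R := to_ell2 (l2_indic R x).

Lemma ip2_delta x u : ip2 (delta x) u = u x.
Proof. exact: inner_indic (ell2_l2 u). Qed.

Lemma ip2_delta_norm x : ip2 (delta x) (delta x) = 1.
Proof. exact: inner_indic_norm. Qed.

Lemma kernE i x y : kern i \1_[set y] x = kernT i \1_[set x] y.
Proof.
rewrite -(kern2E i (delta y)) -(kernT2E i (delta x)) -!ip2_delta.
by rewrite (psdC IP) kern_adjoint.
Qed.

Lemma l2_kern i x : l2 (kern i \1_[set x]).
Proof. by rewrite -(kern2E i (delta x)); exact: ell2_l2. Qed.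

Lemma l2_kernT i x : l2 (kernT i \1_[set x]).
Proof. by rewrite -(kernT2E i (delta x)); exact: ell2_l2. Qed.

Hypothesis rho_ge1 : 1 <= rho.
Hypothesis normA : opnorm (adjacency (R := R) G) = rho.

Let rho_gt0 : 0 < rho := lt_le_trans ltr01 rho_ge1.

Lemma T2_norm u : `|ip2 u (T2 u)| <= ip2 u u.
Proof.
rewrite -ler_sqr ?nnegrE ?(psd_ge0 IP)// real_normK ?num_real//.
apply: le_trans (psd_CauchySchwarz IP _ _) _.
rewrite [leRHS]expr2 ler_wpM2l ?(psd_ge0 IP)// /T2 (psdZl IP) (psdZr IP).
rewrite mulrA -invfM ler_pdivrMl ?mulr_gt0// -expr2.
exact: (opnorm_le normA (ell2_l2 u)).
Qed.

Let F2_contr u : ip2 (F2 u) (F2 u) <= ip2 u u.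
Proof.
apply: (le_trans (B_contr IP B2_sym (@restr_idem _ _) _)).
exact: (iter_lazy_contr IP T2_sym T2_norm).
Qed.

Let adjointB (F' G' : ell2 R -> ell2 R) u v : adjoint ip2 F' G' ->
  F' (u - v) = F' u - F' v.
Proof.
move=> FG; apply/eqP; rewrite -subr_eq0; apply/eqP/ip2_eq0.
set z := _ - (_ - _); rewrite {1}/z !(psdBl IP) !FG -!(psdBl IP) subrr.
by have := psdZl IP 0 0 (G' z); rewrite scale0r mul0r.
Qed.

(** With [F] and [G] for [F2] and [G2], [(1 - G F)^i G = G (1 - F G)^i], so the sum telescopes to at
    most [||1_x||^2 = 1]. Off [S] every term vanishes, because [G] first restricts to [S]. *)
Lemma sum_kernT_le M x :
  \sum_(i < M) inner (kernT i \1_[set x]) (kernT i \1_[set x]) <= (S x)%:R.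
Proof.
have kE i : inner (kernT i \1_[set x]) (kernT i \1_[set x]) =
    ip2 (kernT2 i (delta x)) (kernT2 i (delta x)).
  by rewrite -(kernT2E i (delta x)).
rewrite (eq_bigr (fun i : 'I_M => ip2 (kernT2 i (delta x)) (kernT2 i (delta x))));
  last by move=> i _; rewrite kE.
have GF2 := adjoint_sym IP FG2.
case: (boolP (S x)) => Sx.
  rewrite -(ip2_delta_norm x).
  apply: (@le_trans _ _ (\sum_(i < M) ip2 (G2 (iter i (deflate G2 F2) (delta x)))
     (G2 (iter i (deflate G2 F2) (delta x))))).
    suff E i : kernT2 i (delta x) = G2 (iter i (deflate G2 F2) (delta x)).
      by apply: ler_sum => i _; rewrite E.
    rewrite /kernT2; elim: i => //= k ->.
    by rewrite [in RHS]/deflate (adjointB _ _ GF2).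
  apply: le_trans (deflate_sum_le IP GF2 _ M _) _.
    by move=> u; apply: (contraction_adjoint IP _ FG2 F2_contr).
  by rewrite gerBl (psd_ge0 IP).
have B0 : B2 (delta x) = 0.
  apply/val_inj/funext => y; change (restr S \1_[set x] y = 0 :> R).
  rewrite /restr; case: ifP => // Sy.
  by rewrite indicE memNset// => /= yx; move: Sx; rewrite -yx Sy.
have op0 F' G' : adjoint ip2 F' G' -> F' 0 = 0.
  by move=> h; have := adjointB 0 0 h; rewrite !subrr.
rewrite big1// => i _; rewrite /kernT2 /G2 /= B0 (op0 _ _ (adjoint_iter n Z2_sym)).
have -> : iter i (deflate F2 G2) 0 = 0.
  elim: (i : nat) => //= k ->; exact: (op0 _ _ (deflate_sym IP FG2)).
by have := psdZl IP 0 0 0; rewrite scale0r mul0r.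
Qed.

Variables (r : nat) (P : set R -> (nat -> R) -> nat -> R) (theta : R).
Hypothesis d_gt0 : (0 < d)%N.
Hypothesis r_gt0 : (0 < r)%N.
Hypothesis netS : forall x, reach G S r x.
Hypothesis PP : spectral_projections (adjacency G) P.
Hypothesis theta_le2 : theta <= 2.

(** [spectral_bound] at [1_x], with [T = A / rho], [B] the restriction to [S] and [th0] the gap of
    the net. *)
Lemma projection_kern_le M x : (0 < M)%N ->
  ((1 - theta / 2) ^+ 2) ^+ n *
    inner \1_[set x] (P `[rho * (1 - theta), rho] \1_[set x]) <=
  4 * ((1 - theta / 2) ^+ 2) ^+ n *
    (\sum_(i < M) inner (kern i \1_[set x]) (kern i \1_[set x])) +
  4 / net_gap_width rho r *
    (4 * (1 - net_gap_width rho r / 8) ^+ (n + n) + 5 / (M + M)%:R).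
Proof.
move=> M0; have mE : measurable `[rho * (1 - theta), rho] by [].
pose P2 := projection2 PP mE.
have := @spectral_bound R (ell2 R) ip2 IP T2 B2 P2 (net_gap_width rho r)
  ((1 - theta / 2) ^+ 2) T2_sym T2_norm B2_sym (@restr_idem R S).
have th0 := net_gap_width_gt0 rho_ge1 r_gt0.
have th1 := net_gap_width_le1 rho_ge1 r_gt0.
move=> /(_ th0 th1) h.
have gap u : ip2 (u - B2 u) (T2 (u - B2 u)) <=
    (1 - net_gap_width rho r) * ip2 (u - B2 u) (u - B2 u).
  rewrite /B2 restrC /T2 (psdZr IP) ler_pdivrMl// mulrA.
  by apply: net_gap => //; rewrite restr_idem.
have := h gap (projection_adjoint PP mE) (projection_norm PP mE) (sqr_ge0 _).
move=> /(_ (fun u => projection_lazy PP mE u rho_gt0 theta_le2) n M (delta x) M0).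
rewrite ip2_delta_norm mulr1 projection_norm => h'.
rewrite (_ : \sum_(i < M) inner _ _ =
  \sum_(i < M) ip2 (kern2 i (delta x)) (kern2 i (delta x)))//.
by apply: eq_bigr => i _; rewrite -(kern2E i (delta x)).
Qed.

End Kernels.

(** * Bernoulli subsets and isomorphic balls *)

Definition update (w : pred nat) (a : nat) (b : bool) : pred nat :=
  fun x => if x == a then b else w x.

(* The expectation of [Phi] when the membership of the points of [s] is decided
   by independent Bernoulli([p]) variables and that of the others by [w]. *)
Fixpoint avg (R : realType) (p : R) (s : seq nat) (Phi : pred nat -> R)
    (w : pred nat) : R :=
  if s is a :: s' then
    p * avg p s' Phi (update w a true) + (1 - p) * avg p s' Phi (update w a false)
  else Phi w.

Section Average.
Variables (R : realType) (p : R).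
Implicit Types (s t : seq nat) (Phi Psi : pred nat -> R) (w : pred nat).
Local Notation avg := (avg p).

Lemma avg_cat s t Phi w : avg (s ++ t) Phi w = avg s (avg t Phi) w.
Proof. by elim: s w => //= a s IH w; rewrite !IH. Qed.

Lemma avg_ext s Phi Psi w :
  (forall w', (forall x, x \notin s -> w' x = w x) -> Phi w' = Psi w') ->
  avg s Phi w = avg s Psi w.
Proof.
elim: s w => [|a s IH] w h /=; first exact: h.
by congr (_ * _ + _ * _); apply: IH => w' w'E; apply: h => x;
  rewrite inE negb_or => /andP[/negbTE xa xs]; rewrite w'E// /update xa.
Qed.

Lemma avg_cst s c w : avg s (fun=> c) w = c.
Proof. by elim: s w => //= a s IH w; rewrite !IH; lra. Qed.

Lemma avgD s Phi Psi w :
  avg s (fun w => Phi w + Psi w) w = avg s Phi w + avg s Psi w.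
Proof. by elim: s w => //= a s IH w; rewrite !IH; lra. Qed.

Lemma avgZ s c Phi w : avg s (fun w => c * Phi w) w = c * avg s Phi w.
Proof. by elim: s w => //= a s IH w; rewrite !IH; lra. Qed.

Lemma avg_swap s t Phi w : avg s (avg t Phi) w = avg t (avg s Phi) w.
Proof.
have update_comm a b x y w' : a != b ->
    update (update w' a x) b y = update (update w' b y) a x.
  move=> ab; apply/funext => z; rewrite /update.
  by case: (eqVneq z b) => // ->; rewrite eq_sym (negbTE ab).
have swap1 a Psi w' : avg [:: a] (avg t Psi) w' = avg t (avg [:: a] Psi) w'.
  elim: t w' => //= b t IH w'.
  have [<-|ab] := eqVneq a b.
    (* When the two sites coincide the later update overrides the earlier, and both orders average
       the same variable. *)
    have uu x y : update (update w' a x) a y = update w' a y.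
      by apply/funext => z; rewrite /update; case: eqP.
    by rewrite !uu -!IH /= !uu; lra.
  by rewrite -!IH /= !(update_comm _ _ _ _ _ ab); lra.
elim: s w => // a s IH w.
rewrite -[in LHS]cat1s avg_cat.
rewrite (_ : avg s (avg t Phi) = avg t (avg s Phi)); last exact/funext.
by rewrite swap1.
Qed.

Lemma avg_perm s t Phi w : perm_eq s t -> avg s Phi w = avg t Phi w.
Proof.
move=> st; apply: (catCA_perm_ind (P := fun u => avg s Phi w = avg u Phi w) _ st) => //.
move=> s1 s2 s3 ->; rewrite !avg_cat.
have cat u v : avg (u ++ v) Phi = avg u (avg v Phi).
  by apply/funext => w'; rewrite avg_cat.
by rewrite !cat avg_swap.
Qed.

(** Sites outside [D] average out, as their weights [p] and [1 - p] add up to one. *)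
Lemma avg_insensitive s (D : pred nat) Phi w :
  (forall w w', (forall x, D x -> w x = w' x) -> Phi w = Phi w') ->
  avg s Phi w = avg [seq x <- s | D x] Phi w.
Proof.
move=> h.
have dep t w1 w2 : (forall x, D x -> w1 x = w2 x) -> avg t Phi w1 = avg t Phi w2.
  elim: t w1 w2 => [|b t IH] w1 w2 ww /=; first exact: h.
  by congr (_ * _ + _ * _); apply: IH => x Dx; rewrite /update;
    case: eqP => // _; exact: ww.
elim: s w => //= a s IH w; case: ifPn => Da /=; first by rewrite !IH.
rewrite !(dep s (update w a _) w); first by rewrite -IH; lra.
all: by move=> x Dx; rewrite /update; case: eqP => // xa; rewrite xa (negbTE Da) in Dx.
Qed.

(** Both averages reduce to the sites of [D]. This compares averages over balls around different
    roots. *)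
Lemma avg_local s t (D : pred nat) Phi w :
  (forall w w', (forall x, D x -> w x = w' x) -> Phi w = Phi w') ->
  uniq s -> uniq t -> {subset D <= s} -> {subset D <= t} ->
  avg s Phi w = avg t Phi w.
Proof.
move=> h us ut Ds Dt; rewrite (avg_insensitive s w h) (avg_insensitive t w h).
apply: avg_perm; apply: uniq_perm; rewrite ?filter_uniq// => x.
by rewrite !mem_filter; case: (boolP (D x)) => //= Dx; rewrite Ds ?Dt.
Qed.

Lemma avg_rel (D : set nat) (f : nat -> nat) s Phi Psi w w' :
  {in D &, injective f} -> (forall x, x \in s -> D x) ->
  (forall w w', (forall x, D x -> w x = w' (f x)) -> Phi w = Psi w') ->
  (forall x, D x -> w x = w' (f x)) ->
  avg s Phi w = avg [seq f x | x <- s] Psi w'.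
Proof.
move=> finj + h; elim: s w w' => [|a s IH] w w' sD ww /=; first exact: h.
have Da : D a by apply: sD; rewrite mem_head.
congr (_ * _ + _ * _); apply: IH => [x xs|x Dx]; try by apply: sD; rewrite inE xs orbT.
all: rewrite /update; case: eqVneq => [->|xa]; rewrite ?eqxx//.
all: by case: eqP => [/finj fxa|_]; [rewrite fxa ?inE// eqxx in xa|exact: ww].
Qed.

Lemma avg_series s (f : pred nat -> nat -> R) N w : 0 <= p <= 1 ->
  (forall w x, 0 <= f w x) -> (forall w, series_of (f w) = (N w)%:E) ->
  series_of (fun x => avg s (fun w => f w x) w) = (avg s N w)%:E.
Proof.
move=> /andP[p0 p1] f0 fN.
have q0 : 0 <= 1 - p by rewrite subr_ge0.
have avg0 t x w' : 0 <= avg t (fun w => f w x) w'.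
  by elim: t w' => //= a t IH w'; rewrite addr_ge0 ?mulr_ge0.
elim: s w => //= a s IH w.
rewrite series_ofD; [|by move=> x; rewrite mulr_ge0..].
by rewrite !series_ofZ// !IH.
Qed.

Lemma le_avg s Phi Psi w : 0 <= p <= 1 ->
  (forall w, Phi w <= Psi w) -> avg s Phi w <= avg s Psi w.
Proof.
move=> /andP[p0 p1] h; elim: s w => //= a s IH w.
by rewrite lerD// ler_wpM2l// subr_ge0.
Qed.

Lemma avg_member s o w : uniq s -> o \in s ->
  avg s (fun w => (w o)%:R) w = p.
Proof.
move=> us os; rewrite (@avg_local s [:: o] (pred1 o))//.
- by rewrite /= /update eqxx mulr1 mulr0 addr0.
- by move=> w1 w2 h; rewrite h//=.
- by move=> x /eqP ->.
- by move=> x; rewrite !inE.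
Qed.

(** The sites of [t] are empty independently, each with probability [1 - p]. *)
Lemma avg_avoid s t w : uniq s -> uniq t -> {subset t <= s} ->
  avg s (fun w => (~~ has w t)%:R) w = (1 - p) ^+ size t.
Proof.
move=> us ut ts; rewrite (@avg_local s t (mem t))//; last first.
  by move=> w1 w2 h; rewrite (eq_in_has h).
elim: t w ut {ts} => [|a t IH] w //= /andP[at' ut].
rewrite exprS -(IH (update w a false))//.
rewrite (@avg_ext t _ (fun=> 0)); last first.
  by move=> w' h; rewrite h// /update eqxx.
rewrite avg_cst mulr0 add0r; congr (_ * _).
by apply: avg_ext => w' h; rewrite h// /update eqxx.
Qed.

End Average.

(** * Balls and their isomorphisms *)

Section Balls.
Variables (d k : nat).
Implicit Types (g h : marked_graph d k) (r j x y z : nat).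

Lemma ball_root g j x : x \in (g.2 : seq nat) -> ball_around g j x.
Proof. by move=> xg; exists x, [::]. Qed.

Lemma ball0P g x : ball_around g 0 x -> x \in (g.2 : seq nat).
Proof. by move=> [v [p [vg _ <-]]]; rewrite leqn0 => /nilP ->. Qed.

Lemma ball_mono g i j x : (i <= j)%N -> ball_around g i x -> ball_around g j x.
Proof.
move=> ij [v [p [vg vp px pl]]]; exists v, p; split=> //; exact: leq_trans pl ij.
Qed.

Lemma ball_step g j x y : ball_around g j x -> edge g.1 x y -> ball_around g j.+1 y.
Proof.
move=> [v [p [vg vp px pj]]] xy; exists v, (rcons p y).
by rewrite rcons_path vp last_rcons size_rcons ltnS px.
Qed.

Lemma ball_pred g j y : ball_around g j.+1 y ->
  ball_around g j y \/ exists2 x, ball_around g j x & edge g.1 x y.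
Proof.
move=> [v [p [vg]]]; case/lastP: p => [_ /= <- _|p z].
  by left; exact: ball_root.
rewrite rcons_path last_rcons size_rcons ltnS => /andP[vp pz] <- pj.
by right; exists (last v p) => //; exists v, p.
Qed.

Lemma ball_finite g j : finite_set (ball_around g j).
Proof.
elim: j => [|j IH].
  apply: (@sub_finite_set _ _ [set` (g.2 : seq nat)]); last exact: finite_seq.
  by move=> x /ball0P.
apply: (@sub_finite_set _ _ (ball_around g j `|`
    \bigcup_(x in ball_around g j) [set y | edge g.1 x y])).
  by move=> y /ball_pred[?|[x gx xy]]; [left|right; exists x].
by rewrite finite_setU; split=> //; apply: bigcup_finite => // x _;
  exact: nbrs_finite.
Qed.

Definition ball_list g j : {fset nat} := fset_set (ball_around g j).

Lemma ball_listP g j x : reflect (ball_around g j x) (x \in ball_list g j).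
Proof.
rewrite in_fset_set; last exact: ball_finite.
by apply: (iffP idP) => [/set_mem|/mem_set].
Qed.

(** The body of [ball_iso] with the map as a parameter. *)
Definition local_iso r g h f :=
  [/\ set_bij (ball_around g r) (ball_around h r) f,
      map f g.2 = h.2 &
      forall x y, ball_around g r x -> ball_around g r y ->
        edge h.1 (f x) (f y) = edge g.1 x y].

Section Iso.
Variables (r : nat) (g h : marked_graph d k) (f : nat -> nat).
Hypothesis iso : local_iso r g h f.

Lemma iso_inj x y : ball_around g r x -> ball_around g r y -> f x = f y -> x = y.
Proof.
case: iso => [[_ finj _] _ _] gx gy; apply: finj; exact/mem_set.
Qed.

(** Marked vertices and edges are preserved, hence so is each smaller ball, by induction on its
    radius. *)
Lemma iso_ball j x : (j <= r)%N -> ball_around g j x -> ball_around h j (f x).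
Proof.
case: iso => _ fm fe; elim: j x => [|j IH] x jr.
  by move=> /ball0P xg; apply: ball_root; rewrite -fm map_f.
move=> gx; have /ball_pred[gj|[y gy yx]] := gx.
  by apply: ball_mono (IH x (ltnW jr) gj).
apply: ball_step (IH y (ltnW jr) gy) _.
by rewrite fe//; [apply: ball_mono gy; exact: ltnW|exact: ball_mono gx].
Qed.

Lemma iso_lift j y : (j <= r)%N -> ball_around h j y ->
  exists2 x, ball_around g j x & f x = y.
Proof.
case: iso => [[_ _ fsurj] fm fe]; elim: j y => [|j IH] y jr.
  move=> /ball0P; rewrite -fm => /mapP[x xg ->].
  by exists x => //; exact: ball_root.
move=> hy; have /ball_pred[hj|[z hz zy]] := hy.
  have [x gx <-] := IH y (ltnW jr) hj.
  by exists x => //; exact: ball_mono gx.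
have [t gt tz] := IH z (ltnW jr) hz.
have [x gx xy] := fsurj y (ball_mono jr hy).
exists x => //; apply: (ball_step gt).
by rewrite -fe ?tz ?xy//; apply: ball_mono gt; exact: ltnW.
Qed.

(** The strict [j < r] keeps all neighbours of [x] inside the ball on which [f] is an isomorphism;
    those of [f x] lift back. *)
Lemma iso_nbrs j x : (j < r)%N -> ball_around g j x ->
  perm_eq [seq f y | y <- nbrs g.1 x] (nbrs h.1 (f x)).
Proof.
move=> jr gx; have [_ _ fe] := iso.
have gxr : ball_around g r x by apply: ball_mono gx; exact: ltnW.
have nbr y : edge g.1 x y -> ball_around g r y.
  by move=> xy; apply: ball_mono (ball_step gx xy).
apply: uniq_perm; rewrite ?fset_uniq//.
  rewrite map_inj_in_uniq ?fset_uniq// => y z.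
  by rewrite !in_nbrs => xy xz; apply: iso_inj; exact: nbr.
move=> y'; rewrite in_nbrs; apply/mapP/idP => [[y + ->]|xy'].
  by rewrite in_nbrs => xy; rewrite fe//; exact: nbr.
have [y gy yy'] := iso_lift jr (ball_step (iso_ball (ltnW jr) gx) xy').
exists y => //; rewrite in_nbrs -fe ?yy'//.
exact: ball_mono gy.
Qed.

Lemma iso_ball_list j : (j <= r)%N ->
  perm_eq [seq f x | x <- ball_list g j] (ball_list h j).
Proof.
move=> jr; apply: uniq_perm; rewrite ?fset_uniq//.
  rewrite map_inj_in_uniq ?fset_uniq// => y z /ball_listP gy /ball_listP gz.
  by apply: iso_inj; apply: ball_mono jr _.
move=> y; apply/mapP/ball_listP => [[x /ball_listP gx ->]|].
  exact: iso_ball.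
by move=> /(iso_lift jr)[x gx <-]; exists x => //; exact/ball_listP.
Qed.

End Iso.

Lemma local_iso_id r g : local_iso r g g id.
Proof.
split; [|exact: map_id|by []].
by split=> [x|x y _ _|x gx]//; exists x.
Qed.

End Balls.

(** * Locality of the kernels *)

Section Agreement.
Variables (R : realType) (d k : nat) (r : nat) (g h : marked_graph d k).
Variable f : nat -> nat.
Hypothesis iso : local_iso r g h f.
Implicit Types (i j : nat).

(** The functions match through [f] up to distance [j] from the marked vertices; each adjacency step
    consumes one unit of [j]. *)
Definition agree (X : Type) j (psi psi' : nat -> X) :=
  forall x, ball_around g j x -> psi x = psi' (f x).

Lemma agree_le (X : Type) i j (psi psi' : nat -> X) : (i <= j)%N ->
  agree j psi psi' -> agree i psi psi'.
Proof. by move=> ij h' x gx; apply: h'; exact: ball_mono gx. Qed.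

Lemma agree_reach i j (w w' : pred nat) : (i + j <= r)%N ->
  agree (i + j) w w' -> agree j (reach g.1 w i) (reach h.1 w' i).
Proof.
elim: i j => [|i IH] j ir ww x gx; first exact: ww.
rewrite /= (IH j (ltnW ir) (agree_le (leqnSn _) ww) x gx); congr (_ || _).
have jr : (j < r)%N by apply: leq_trans ir; rewrite addSn ltnS leq_addl.
have hasE (p : pred nat) s t : perm_eq s t -> has p s = has p t.
  by move=> st; rewrite !has_count; have /permP -> := st.
rewrite -(hasE _ _ _ (iso_nbrs iso jr gx)) has_map; apply: eq_in_has => y.
rewrite in_nbrs => xy /=; rewrite (IH j.+1) ?addnS//.
exact: ball_step xy.
Qed.

Lemma agree_cover i j (w w' : pred nat) : (i + j <= r)%N ->
  agree (i + j) w w' -> agree j (cover_set g.1 w i) (cover_set h.1 w' i).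
Proof.
move=> ir ww x gx; rewrite /cover_set (agree_reach ir ww gx).
by rewrite (ww x)//; apply: ball_mono gx; exact: leq_addl.
Qed.

Variables (rho : R) (n : nat).
Implicit Types psi : nat -> R.
Local Notation walkop := (walkop (R := R)).

Lemma agree_adjacency j psi psi' : (j < r)%N ->
  agree j.+1 psi psi' -> agree j (adjacency g.1 psi) (adjacency h.1 psi').
Proof.
move=> jr pp x gx; rewrite !adjacencyE -(perm_big _ (iso_nbrs iso jr gx)) big_map.
apply: eq_big_seq => y; rewrite in_nbrs => xy.
by apply: pp; exact: ball_step xy.
Qed.

Lemma agree_walkop j psi psi' : (j < r)%N -> agree j.+1 psi psi' ->
  agree j (walkop g.1 rho psi) (walkop h.1 rho psi').
Proof.
move=> jr pp x gx.
change (2^-1 * (psi x + rho^-1 * adjacency g.1 psi x) =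
  2^-1 * (psi' (f x) + rho^-1 * adjacency h.1 psi' (f x))).
by rewrite (agree_adjacency jr pp gx) (pp x)//; exact: ball_mono gx.
Qed.

Lemma agree_iter_walkop m j psi psi' : (m + j <= r)%N -> agree (m + j) psi psi' ->
  agree j (iter m (walkop g.1 rho) psi) (iter m (walkop h.1 rho) psi').
Proof.
elim: m j => // m IH j mr pp; rewrite !iterS; apply: agree_walkop.
  by apply: leq_trans mr; rewrite addSn ltnS leq_addl.
by apply: IH; rewrite addnS.
Qed.

Variables S S' : pred nat.

Lemma agree_restr j psi psi' : agree j S S' -> agree j psi psi' ->
  agree j (restr S psi) (restr S' psi').
Proof. by move=> SS pp x gx; rewrite /restr SS// pp. Qed.

Local Notation tto := (trace_to g.1 rho n S).
Local Notation tto' := (trace_to h.1 rho n S').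
Local Notation tfrom := (trace_from g.1 rho n S).
Local Notation tfrom' := (trace_from h.1 rho n S').

Lemma agree_trace_to j psi psi' : (n + j <= r)%N -> agree j S S' ->
  agree (n + j) psi psi' -> agree j (tto psi) (tto' psi').
Proof.
by move=> nr SS pp; apply: agree_restr => //; exact: agree_iter_walkop.
Qed.

Lemma agree_trace_from j psi psi' : (n + j <= r)%N -> agree (n + j) S S' ->
  agree (n + j) psi psi' -> agree j (tfrom psi) (tfrom' psi').
Proof.
by move=> nr SS pp; apply: agree_iter_walkop => //; exact: agree_restr.
Qed.

(** One deflation applies the walk operator [2n] times, hence looks [2n] further. *)
Lemma agree_iter_deflate i j psi psi' : (i * (n + n) + j <= r)%N ->
  agree (i * (n + n) + j) S S' -> agree (i * (n + n) + j) psi psi' ->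
  agree j (iter i (deflate tto tfrom) psi) (iter i (deflate tto' tfrom') psi').
Proof.
elim: i j => // i IH j ir SS pp; rewrite !iterS.
have e : (i.+1 * (n + n) + j)%N = (i * (n + n) + (n + (n + j)))%N.
  by rewrite mulSn (addnC (n + n)%N) -!addnA.
rewrite e in ir SS pp.
have := IH _ ir SS pp; set u := iter _ _ psi; set u' := iter _ _ psi' => uu.
have nnr : (n + (n + j) <= r)%N by apply: leq_trans ir; exact: leq_addl.
have SS' : agree (n + j) S S'.
  by apply: agree_le SS; rewrite addnA leq_addl.
have tt : agree j (tfrom (tto u)) (tfrom' (tto' u')).
  apply: agree_trace_from => //; last exact: agree_trace_to.
  by apply: leq_trans nnr; exact: leq_addl.
move=> x gx; change (u x - tfrom (tto u) x = u' (f x) - tfrom' (tto' u') (f x)).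
rewrite (tt x gx) (uu x)//; apply: ball_mono gx.
by rewrite addnA leq_addl.
Qed.

Lemma agree_kern i j psi psi' : (i * (n + n) + (n + j) <= r)%N ->
  agree (i * (n + n) + (n + j)) S S' -> agree (i * (n + n) + (n + j)) psi psi' ->
  agree j (kern g.1 rho n S i psi) (kern h.1 rho n S' i psi').
Proof.
move=> ir SS pp; apply: agree_trace_to.
- by apply: leq_trans ir; exact: leq_addl.
- by apply: agree_le SS; rewrite addnA leq_addl.
- exact: agree_iter_deflate.
Qed.

Lemma agree_kernT i j psi psi' : (i * (n + n) + (n + j) <= r)%N ->
  agree (i * (n + n) + (n + j)) S S' -> agree (i * (n + n) + (n + j)) psi psi' ->
  agree j (kernT g.1 rho n S i psi) (kernT h.1 rho n S' i psi').
Proof.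
rewrite [(n + j)%N]addnC addnA addnC => ir SS pp; apply: agree_iter_deflate.
- by apply: leq_trans ir; exact: leq_addl.
- by apply: agree_le SS; exact: leq_addl.
- exact: agree_trace_from.
Qed.

End Agreement.

(** * Mass transport *)

Section LowerIntegral.
Import HBNNSimple.

(* The integral of a nonnegative function is defined as a supremum over the
   simple functions below it, so that monotonicity needs no measurability. *)
Lemma ae_ge0_le_integral_nonmeasurable d (T : measurableType d) (R : realType)
    (mu : {measure set T -> \bar R}) (f g : T -> \bar R) :
  (forall x, 0 <= f x)%E -> (forall x, 0 <= g x)%E ->
  {ae mu, forall x, (f x <= g x)%E} ->
  (\int[mu]_x f x <= \int[mu]_x g x)%E.
Proof.
move=> f0 g0 [N [mN N0 fgN]].
rewrite !ge0_integralTE//; apply: ge_ereal_sup => _ [h hf <-].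
have mC : measurable (~` N) by exact: measurableC.
(* Cutting [h] to zero on the null set puts it below [g] everywhere without changing its
   integral. *)
apply: ereal_sup_ubound; exists (proj_nnsfun h mC).
  move=> x; rewrite /proj_nnsfun /= mindicE.
  have [xN|xN] := pselect (N x).
    by rewrite memNset ?mulr0.
  rewrite mem_set// mulr1; apply: le_trans (hf x) _.
  by apply: contrapT => fg; apply: xN; apply: fgN.
rewrite -!integralT_nnsfun; apply: ae_eq_integral => //.
- exact/measurable_EFinP.
- exact/measurable_EFinP.
- exists N; split=> // x /= /not_implyP[_ hx]; apply: contrapT => xN; apply: hx.
  by rewrite /proj_nnsfun /= mindicE mem_set// mulr1.
Qed.

End LowerIntegral.

(** * Volume growth of balls *)

Section BallVolume.
Variables (R : realType) (d : nat) (G : regular_graph d) (rho : R) (o : nat).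

Local Notation A := (adjacency G : (nat -> R) -> nat -> R).
Local Notation g := ((G, [tuple o]) : marked_graph d 1).

Lemma reach_ball (w : pred nat) r : has w (ball_list g r) -> reach G w r o.
Proof.
move=> /hasP[y /ball_listP]; elim: r w y => [|r IH] w y.
  by move=> /ball0P; rewrite inE => /eqP ->.
move=> /ball_pred[gy|[z gz zy]] wy /=; first by rewrite (IH _ y).
have h : reach G (reach G w 1) r o.
  apply: (IH _ z) => //=; apply/orP; right; apply/hasP; exists y => //.
  by rewrite in_nbrs.
(* Enlarging the target by one step first is the same as searching one step further. *)
have comm i x : reach G (reach G w 1) i x = reach G w i.+1 x.
  elim: i x => // i IHi x; rewrite [LHS]/= IHi [RHS]/=; congr (_ || _).
  by apply: eq_has => t; rewrite IHi.
by rewrite comm in h.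
Qed.

Hypothesis normA : opnorm (adjacency (R := R) G) = rho.

(** Walks of length [r] from [o] stay in the ball [B], so [<1_B, A^r 1_o> = d^r]; Cauchy-Schwarz
    bounds its square by [|B| rho^(2r)]. *)
Lemma ball_volume r :
  (d%:R ^+ (r + r) : R) <= (size (ball_list g r))%:R * rho ^+ (r + r).
Proof.
pose b : ell2 R := \sum_(z <- ball_list g r) delta R z.
have bE x : b x = (x \in ball_list g r)%:R.
  have -> : b x = \sum_(z <- ball_list g r) (\1_[set z] x : R).
    rewrite /b; elim: (ball_list g r : seq nat) => [|z s IH].
      by rewrite !big_nil.
    by rewrite !big_cons -IH.
  have [xs|xs] := boolP (x \in _).
    rewrite (big_fsetD1 x)//= indicE mem_set// big_seq big1 ?addr0// => y.
    rewrite !inE => /andP[yx _]; rewrite indicE memNset//= => xy.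
    by rewrite xy eqxx in yx.
  rewrite big_seq big1// => y ys; rewrite indicE memNset//= => xy.
  by rewrite xy ys in xs.
have nb : ip2 b b = (size (ball_list g r))%:R.
  have IP := ip2_psd R.
  have sumE s : ip2 (\sum_(z <- s) delta R z) b = \sum_(z <- s) b z.
    elim: s => [|z s IH].
      by rewrite !big_nil; have := psdZl IP 0 0 b; rewrite scale0r mul0r.
    by rewrite !big_cons (psdDl IP) IH ip2_delta.
  rewrite {1}/b sumE big_seq (eq_bigr (fun=> 1)); last by move=> z zs; rewrite bE zs.
  by rewrite -big_seq big_const_seq count_predT iter_addr_0.
have Ab : iter r A b o = d%:R ^+ r.
  suff h i j x : (i + j = r)%N -> ball_around g j x -> iter i A b x = d%:R ^+ i.
    by apply: (h r 0%N); rewrite ?addn0//; apply: ball_root; rewrite inE.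
  elim: i j x => [|i IH] j x.
    by rewrite add0n => -> gx; rewrite /= bE expr0; case: ball_listP.
  rewrite addSnnS => ijr gx; rewrite iterS adjacencyE.
  rewrite (eq_big_seq (fun=> d%:R ^+ i)); last first.
    by move=> y; rewrite in_nbrs => xy; apply: (IH j.+1) => //; exact: (ball_step gx xy).
  by rewrite big_const_seq count_predT iter_addr_0 size_nbrs exprS mulr_natl.
have := psd_CauchySchwarz (ip2_psd R) b (iter r (@adjacency2 R d G) (delta R o)).
have -> : ip2 b (iter r (@adjacency2 R d G) (delta R o)) = d%:R ^+ r.
  have AA : adjoint (@ip2 R) (@adjacency2 R d G) (@adjacency2 R d G).
    exact: adjacency_adjoint.
  rewrite -(adjoint_iter r AA) (psdC (ip2_psd R)) ip2_delta iter_adjacency2.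
  exact: Ab.
rewrite -exprM muln2 -addnn nb; move=> h; apply: le_trans h _.
rewrite ler_wpM2l//.
apply: le_trans (iter_adjacency2_norm normA r (delta R o)) _.
by rewrite [inner _ _]ip2_delta_norm mulr1.
Qed.

End BallVolume.

(** * The transported mass and its two marginals *)

Section Transport.
Variables (R : realType) (d : nat) (rho p e : R) (r n M : nat).
Hypothesis p01 : 0 <= p <= 1.
Hypothesis e_ge0 : 0 <= e.

Local Notation ker G w := (kern G rho n (cover_set G w r)).
Local Notation kerT G w := (kernT G rho n (cover_set G w r)).

(** Bounds the range of the kernels of index below [M]; [radius] adds the [r] steps that decide
    membership in [cover_set]. *)
Definition reach_length := (M * (n + n) + n)%N.
Definition radius := (r + reach_length)%N.

(** Squared kernel entries with an error [e] on the diagonal. The sum over [x] serves to bound the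
    projection at [y]; the sum over [y] is controlled by the net at [x]. *)
Definition mass (G : regular_graph d) (w : pred nat) (x y : nat) : R :=
  4 * (\sum_(i < M) ker G w i \1_[set y] x ^+ 2) + e * (x == y)%:R.

(** A finite average replaces an infinite random set: the ball contains every site on which the mass
    depends. *)
Definition transport (g : marked_graph d 2) : R :=
  avg p (ball_list g radius)
    (fun w => mass g.1 w (thead g.2) (thead (behead_tuple g.2))) pred0.

Lemma mass_ge0 G w x y : 0 <= mass G w x y.
Proof.
by rewrite addr_ge0 ?mulr_ge0// sumr_ge0// => i _; rewrite sqr_ge0.
Qed.

Lemma transport_ge0 g : 0 <= transport g.
Proof.
rewrite -(avg_cst p (ball_list g radius) 0 pred0); apply: le_avg => // w.
exact: mass_ge0.
Qed.

Section MassAgree.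
Variables (k : nat) (g h : marked_graph d k) (f : nat -> nat).
Hypothesis iso : local_iso radius g h f.

Let level (i : 'I_M) : (i * (n + n) + (n + 0) <= reach_length)%N.
Proof.
by rewrite addn0 /reach_length leq_add2r leq_mul2r orbC (ltnW (ltn_ord i)).
Qed.

Let level' (i : 'I_M) : (i * (n + n) + (n + 0) <= radius)%N.
Proof. exact: leq_trans (level i) (leq_addl _ _). Qed.

Let agree_S (i : 'I_M) (w w' : pred nat) : agree g f radius w w' ->
  agree g f (i * (n + n) + (n + 0)) (cover_set g.1 w r) (cover_set h.1 w' r).
Proof. by move=> ww; apply: agree_le (level i) _; exact: (agree_cover iso). Qed.

Let indic_eq (x y : nat) : (\1_[set y] x : R) = (x == y)%:R.
Proof.
rewrite indicE; congr (_%:R); congr nat_of_bool.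
by apply/idP/eqP => [/set_mem|/mem_set].
Qed.

Lemma mass_agree w w' x y : agree g f radius w w' ->
  x \in (g.2 : seq nat) -> agree g f radius (\1_[set y] : nat -> R) \1_[set f y] ->
  mass g.1 w x y = mass h.1 w' (f x) (f y).
Proof.
move=> ww xg yy; rewrite /mass -!indic_eq yy; last exact: ball_root.
congr (4 * _ + _); apply: eq_bigr => i _; congr (_ ^+ 2).
have := @agree_kern R d k radius g h f iso rho n _ _ i 0 \1_[set y] \1_[set f y]
  (level' i) (@agree_S i w w' ww) (agree_le (level' i) yy).
by apply; exact: ball_root.
Qed.

(** The entry is read from [y] through the adjoint kernel, so that [y] is the vertex to be
    marked. *)
Lemma mass_agreeT w w' x y : agree g f radius w w' ->
  y \in (g.2 : seq nat) -> agree g f radius (\1_[set x] : nat -> R) \1_[set f x] ->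
  mass g.1 w x y = mass h.1 w' (f x) (f y).
Proof.
move=> ww yg xx.
rewrite /mass (eq_sym x) (eq_sym (f x)) -!indic_eq xx; last exact: ball_root.
congr (4 * _ + _); apply: eq_bigr => i _; rewrite !kernE; congr (_ ^+ 2).
have := @agree_kernT R d k radius g h f iso rho n _ _ i 0 \1_[set x] \1_[set f x]
  (level' i) (@agree_S i w w' ww) (agree_le (level' i) xx).
by apply; exact: ball_root.
Qed.

End MassAgree.

Lemma transport_iso (g h : marked_graph d 2) : ball_iso radius g h ->
  transport g = transport h.
Proof.
move=> [f iso]; rewrite /transport.
have [_ fm _] := iso.
have [mx my] : thead h.2 = f (thead g.2) /\
    thead (behead_tuple h.2) = f (thead (behead_tuple g.2)).
  move: fm; case: g {iso} => G [[|x [|y [|? ?]]] //= ?].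
  case: h => H [[|x' [|y' [|? ?]]] //= ?].
  by move=> [<- <-].
have gm : (thead g.2 \in (g.2 : seq nat)) /\
    (thead (behead_tuple g.2) \in (g.2 : seq nat)).
  case: g {iso fm mx my} => G [[|x [|y [|? ?]]] //= ?].
  by rewrite !inE !eqxx orbT.
rewrite mx my -(avg_perm p _ pred0 (iso_ball_list iso (leqnn _))).
apply: (@avg_rel _ _ (ball_around g radius)) => //.
- by move=> x y /set_mem gx /set_mem gy; exact: (iso_inj iso).
- by move=> x /ball_listP.
- move=> w w' ww; apply: (mass_agree iso ww gm.1) => z gz.
  rewrite !indicE; congr (_%:R); congr nat_of_bool.
  apply/idP/idP => /set_mem /= h'; apply: mem_set => /=; first by rewrite h'.
  by apply: (iso_inj iso) => //; apply: ball_root; exact: gm.2.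
Qed.

(** [transport] is constant on balls of radius [radius], so every preimage is open. *)
Lemma transport_borel : borel_function (fun g => (transport g)%:E).
Proof.
move=> B _; apply: sub_sigma_algebra => g Bg; exists radius => h gh.
by rewrite /= -(transport_iso gh).
Qed.

Section Root.
Variables (G : regular_graph d) (o : nat).
Local Notation g := ((G, [tuple o]) : marked_graph d 1).

Let ball_sub (m : marked_graph d 2) : m.1 = G -> o \in (m.2 : seq nat) ->
  {subset ball_list g radius <= ball_list m radius}.
Proof.
move=> mG om x /ball_listP[v [q [vg vq qx qr]]]; apply/ball_listP.
by exists v, q; split=> //; [move: vg; rewrite !inE => /eqP ->|rewrite mG].
Qed.

(** Averaging over the ball around [o] alone makes the sites independent of [x], so that the sum
    over [x] can be taken inside. *)
Lemma transport_out x :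
  transport (G, [tuple o; x]) = avg p (ball_list g radius) (fun w => mass G w o x) pred0.
Proof.
apply: (@avg_local _ _ _ _ (mem (ball_list g radius))); rewrite ?fset_uniq//.
  move=> w w' ww; apply: (mass_agree (local_iso_id radius g)) => //.
  + by move=> z gz; apply: ww; exact/ball_listP.
  + by rewrite inE.
by apply: ball_sub => //; rewrite inE eqxx.
Qed.

Lemma transport_in x :
  transport (G, [tuple x; o]) = avg p (ball_list g radius) (fun w => mass G w x o) pred0.
Proof.
apply: (@avg_local _ _ _ _ (mem (ball_list g radius))); rewrite ?fset_uniq//.
  move=> w w' ww; apply: (mass_agreeT (local_iso_id radius g)) => //.
  + by move=> z gz; apply: ww; exact/ball_listP.
  + by rewrite inE.
by apply: ball_sub => //; rewrite !inE eqxx orbT.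
Qed.

Let series_mass (F : 'I_M -> nat -> R) : (forall i, l2 (F i)) ->
  series_of (fun x => 4 * (\sum_(i < M) F i x ^+ 2) + e * (x == o)%:R) =
  (4 * (\sum_(i < M) inner (F i) (F i)) + e)%:E.
Proof.
move=> lF.
have sum0 (s : seq 'I_M) x : 0 <= \sum_(i <- s) F i x ^+ 2.
  by apply: sumr_ge0 => i _; rewrite sqr_ge0.
have sumE (s : seq 'I_M) : series_of (fun x => \sum_(i <- s) F i x ^+ 2) =
    (\sum_(i <- s) inner (F i) (F i))%:E.
  elim: s => [|i s IH].
    rewrite big_nil; apply: eseries0 => x _ _; by rewrite big_nil.
  rewrite big_cons EFinD -IH inner_normE// -series_ofD//; last first.
    by move=> x; rewrite sqr_ge0.
  by apply: eq_eseriesr => x _; rewrite big_cons.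
rewrite series_ofD; [|by move=> x; rewrite mulr_ge0..].
rewrite !series_ofZ// sumE [RHS]EFinD [X in _ = (X + _)%E]EFinM; congr (_ + _)%E.
rewrite -[RHS]mule1 -(sum_sq_indic R o); congr (_ * _)%E.
apply: eq_eseriesr => x _; congr EFin; rewrite indicE.
case: (eqVneq x o) => [->|xo]; first by rewrite mem_set// expr1n.
by rewrite memNset ?expr0n//= => /eqP; rewrite (negbTE xo).
Qed.

(** Squared entries along the row at [o] sum to the squared norms of the adjoint kernels at
    [1_o]. *)
Lemma esum_transport_out :
  (\esum_(x in [set: nat]) (transport (G, [tuple o; x]))%:E =
   (avg p (ball_list g radius) (fun w =>
     4 * (\sum_(i < M) inner (kerT G w i \1_[set o]) (kerT G w i \1_[set o])) + e)
     pred0)%:E)%E.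
Proof.
rewrite -series_of_esum; last by move=> x; exact: transport_ge0.
rewrite (_ : (fun x => _) = fun x =>
    avg p (ball_list g radius) (fun w => mass G w o x) pred0); last first.
  by apply/funext => x; exact: transport_out.
apply: avg_series => // [w x|w]; first exact: mass_ge0.
rewrite -series_mass; last by move=> i; exact: l2_kernT.
apply: eq_eseriesr => x _; congr (4 * _ + _)%:E; last by rewrite eq_sym.
by apply: eq_bigr => i _; rewrite kernE.
Qed.

Lemma esum_transport_in :
  (\esum_(x in [set: nat]) (transport (G, [tuple x; o]))%:E =
   (avg p (ball_list g radius) (fun w =>
     4 * (\sum_(i < M) inner (ker G w i \1_[set o]) (ker G w i \1_[set o])) + e)
     pred0)%:E)%E.
Proof.
rewrite -series_of_esum; last by move=> x; exact: transport_ge0.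
rewrite (_ : (fun x => _) = fun x =>
    avg p (ball_list g radius) (fun w => mass G w x o) pred0); last first.
  by apply/funext => x; exact: transport_in.
apply: avg_series => // [w x|w]; first exact: mass_ge0.
by rewrite -series_mass// => i; exact: l2_kern.
Qed.

End Root.
End Transport.

(** * Bounds on the spectral distribution *)

Section RootBounds.
Variables (R : realType) (d : nat) (rho p e : R) (r n M : nat).
Hypothesis p01 : 0 <= p <= 1.
Hypothesis rho_ge1 : 1 <= rho.
Variables (G : regular_graph d) (o : nat).
Hypothesis normA : opnorm (adjacency (R := R) G) = rho.
Local Notation g := ((G, [tuple o]) : marked_graph d 1).

(** By [sum_kernT_le] it suffices that [o] is rarely in the net: either it is selected, or its whole
    ball [B] is empty. The latter has probability [(1 - p)^|B| <= exp (- p |B|)], and [ball_volume]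
    bounds [|B|] from below. *)
Lemma avg_kernT_le (s : seq nat) : uniq s ->
  {subset ball_list g r <= s} ->
  avg p s (fun w => 4 * (\sum_(i < M)
      inner (kernT G rho n (cover_set G w r) i \1_[set o])
            (kernT G rho n (cover_set G w r) i \1_[set o])) + e) pred0 <=
  4 * (p + expR (- p * (d%:R / rho) ^+ (r + r))) + e.
Proof.
move=> us bs; have rho0 : 0 < rho := lt_le_trans ltr01 rho_ge1.
have os : o \in s by apply/bs/ball_listP/ball_root; rewrite inE.
apply: (@le_trans _ _ (avg p s (fun w =>
    4 * ((w o)%:R + (~~ has w (ball_list g r))%:R) + e) pred0)).
  apply: le_avg => // w; rewrite lerD2r ler_pM2l//.
  apply: le_trans (sum_kernT_le _ _ rho_ge1 normA M o) _.
  have [h|h] := boolP (has w (ball_list g r)).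
    by rewrite /cover_set (reach_ball h) orbF /= addr0.
  by rewrite -natrD ler_nat; case: (cover_set _ _ _ _); rewrite ?addn1.
rewrite !avgD avg_cst avgZ avgD avg_member// avg_avoid// ?fset_uniq//.
rewrite lerD2r ler_pM2l// lerD2l.
have /andP[p0 p1] := p01.
set N := size _; apply: (@le_trans _ _ (expR (- p) ^+ N)).
  by rewrite lerXn2r ?nnegrE ?subr_ge0 ?expR_ge0//; have := expR_ge1Dx (- p).
rewrite -expRM_natr ler_expR !mulNr lerN2 ler_wpM2l//.
rewrite expr_div_n ler_pdivrMr ?exprn_gt0//.
exact: ball_volume.
Qed.

Variables (P : set R -> (nat -> R) -> nat -> R) (theta : R).
Hypothesis d_gt0 : (0 < d)%N.
Hypothesis r_gt0 : (0 < r)%N.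
Hypothesis M_gt0 : (0 < M)%N.
Hypothesis PP : spectral_projections (adjacency G) P.
Hypothesis e_ge0 : 0 <= e.
Hypothesis theta_le2 : theta <= 2.
Hypothesis cn : 1 / 2 <= ((1 - theta / 2) ^+ 2) ^+ n.
Hypothesis e_ge : 8 / net_gap_width rho r *
    (4 * (1 - net_gap_width rho r / 8) ^+ (n + n) + 5 / (M + M)%:R) <= e.

(** Every [cover_set] is a net, so the bound holds for each configuration before averaging. Dividing
    by a power that is at least [1 / 2] turns the [4] of the error in [projection_kern_le] into
    [8]. *)
Lemma avg_kern_ge (s : seq nat) :
  inner \1_[set o] (P `[rho * (1 - theta), rho] \1_[set o]) <=
  avg p s (fun w => 4 * (\sum_(i < M)
      inner (kern G rho n (cover_set G w r) i \1_[set o])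
            (kern G rho n (cover_set G w r) i \1_[set o])) + e) pred0.
Proof.
rewrite -[leLHS](avg_cst p s _ pred0); apply: le_avg => // w.
have := @projection_kern_le R d G rho n (cover_set G w r) rho_ge1 normA r P theta
  d_gt0 r_gt0 (cover_set_net _ _ _) PP theta_le2 M o M_gt0.
move: cn e_ge; rewrite (_ : 8 = 2 * 4 :> R); last by rewrite -natrM.
rewrite -!(mulrA 2) -!(mulrA 4); set Err := 4 * _.
move: (inner _ _) (\sum_(i < M) _) (_ ^+ n) => X Y c cc eE h.
have c0 : 0 < c by lra.
have : 1 / 2 * e <= c * e by rewrite ler_wpM2r.
by move=> ce; rewrite -(ler_pM2l c0); apply: (le_trans h); lra.
Qed.

End RootBounds.

Section ProjectionBounds.
Variables (R : realType) (d : nat) (G : regular_graph d).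
Variable P : set R -> (nat -> R) -> nat -> R.
Hypothesis PP : spectral_projections (adjacency G) P.

Lemma projection_delta_ge0 E o : measurable E ->
  0 <= inner \1_[set o] (P E (\1_[set o] : nat -> R)).
Proof.
move=> mE.
have : 0 <= ip2 (delta R o) (projection2 PP mE (delta R o)).
  by rewrite -projection_norm (psd_ge0 (ip2_psd R)).
exact.
Qed.

Lemma projection_delta_le1 E o : measurable E ->
  inner \1_[set o] (P E (\1_[set o] : nat -> R)) <= 1.
Proof.
move=> mE; rewrite -(ip2_delta_norm R o).
have := @P_contr _ _ _ (ip2_psd R) _ (projection_norm PP mE) (delta R o).
by rewrite projection_norm.
Qed.

End ProjectionBounds.

Section SpectralDistribution.
Variables (R : realType) (d : nat) (rho : R).
Variables (disp : measure_display) (T : measurableType disp).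
Variables (P : probability T R) (X : T -> rooted_graph d).
Variable PG : regular_graph d -> set R -> (nat -> R) -> nat -> R.
Hypothesis PGP : forall G, spectral_projections (adjacency G) (PG G).

Lemma spectral_distribution_le1 E : measurable E ->
  (spectral_distribution P X PG E <= 1)%E.
Proof.
move=> mE; rewrite -(@probability_setT _ _ _ P) -[P setT]mul1e -integral_cst//.
apply: ae_ge0_le_integral_nonmeasurable => //.
  by move=> w; rewrite lee_fin; exact: (projection_delta_ge0 (PGP _)).
by apply: aeW => w; rewrite lee_fin; exact: (projection_delta_le1 (PGP _)).
Qed.

Hypothesis uni : unimodular P X.
Hypothesis normA : {ae P, forall w, opnorm (adjacency (R := R) (X w).1) = rho}.
Hypothesis rho_ge1 : 1 <= rho.

(** The projection is at most the mass received by the root; mass transport trades its expectation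
    for that of the mass sent, which the density of the net bounds. *)
Lemma spectral_distribution_le (p e theta : R) (r n M : nat) :
  (0 < d)%N -> (0 < r)%N -> (0 < M)%N -> 0 <= p <= 1 -> 0 < theta -> theta <= 2 ->
  1 / 2 <= ((1 - theta / 2) ^+ 2) ^+ n ->
  8 / net_gap_width rho r *
    (4 * (1 - net_gap_width rho r / 8) ^+ (n + n) + 5 / (M + M)%:R) <= e ->
  0 <= e ->
  (spectral_distribution P X PG `[(rho * (1 - theta))%R, rho] <=
   (4 * (p + expR (- p * (d%:R / rho) ^+ (r + r))) + e)%:E)%E.
Proof.
move=> d0 r0 M0 p01 t0 t2 cn eE e0.
have tr0 g : 0 <= @transport R d rho p e r n M g by exact: transport_ge0.
pose f (g : marked_graph d 2) := (transport rho p e r n M g)%:E.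
have f0 g : (0 <= f g)%E by rewrite lee_fin tr0.
have es0 (h : nat -> \bar R) : (forall x, 0 <= h x)%E ->
    (0 <= \esum_(x in [set: nat]) h x)%E by move=> h0; apply: esum_ge0.
have step : (spectral_distribution P X PG `[(rho * (1 - theta))%R, rho] <=
    \int[P]_w (\esum_(x in [set: nat]) f ((X w).1, [tuple x; Defs.root (X w)])))%E.
  apply: ae_ge0_le_integral_nonmeasurable => [w|w|].
  - by rewrite lee_fin; exact: (projection_delta_ge0 (PGP _)).
  - exact: es0.
  apply: filterS normA => w nw; rewrite esum_transport_in// lee_fin.
  exact: avg_kern_ge.
apply: (le_trans step); rewrite -uni//; last exact: transport_borel.
rewrite -[leRHS]mule1 -(@probability_setT _ _ _ P) -integral_cst//.
apply: ae_ge0_le_integral_nonmeasurable => [w|w|].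
- exact: es0.
- rewrite lee_fin addr_ge0// mulr_ge0// addr_ge0 ?expR_ge0//.
  by case/andP: p01.
apply: filterS normA => w nw; rewrite esum_transport_out// lee_fin.
apply: avg_kernT_le => //; first exact: fset_uniq.
move=> x /ball_listP h; apply/ball_listP; apply: ball_mono h.
exact: leq_addr.
Qed.

End SpectralDistribution.

(** * Choice of the parameters *)

Section ParameterChoice.
Variables (R : realType) (d : nat) (rho kappa : R).
Hypothesis d_gt0 : (0 < d)%N.
Hypothesis rho_gt1 : 1 < rho.
Hypothesis ln_d : ln d%:R = (1 + kappa) * ln rho.
Hypothesis kappa_gt0 : 0 < kappa.

Let rho_gt0 : 0 < rho := lt_trans ltr01 rho_gt1.

(** Makes [scale_const * r^2 * rho^(2r)] an upper bound for the number [n] of walk steps chosen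
    below. *)
Definition scale_const : R := 8 * (128 + 2 * kappa * ln rho + 2 * ln rho) + 1.

Lemma rho_pow (k : nat) : rho ^+ k = expR (k%:R * ln rho).
Proof. by rewrite expRM_natl lnK. Qed.

Lemma ball_pow (k : nat) : (d%:R / rho) ^+ k = expR (k%:R * (kappa * ln rho)).
Proof.
rewrite expRM_natl; congr (_ ^+ k).
have d0 : 0 < d%:R :> R by rewrite ltr0n.
rewrite -(lnK (d0 : d%:R \is Num.pos)) -{1}(lnK (rho_gt0 : rho \is Num.pos)).
by rewrite -expRN -expRD ln_d; congr expR; rewrite mulrDl mul1r addrC addrA addNr add0r.
Qed.

Lemma choose_parameters (r : nat) (theta : R) : (0 < r)%N -> 0 < theta ->
  theta * (scale_const * r%:R ^+ 2 * expR ((r + r)%:R * ln rho)) <= 1 / 2 ->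
  exists p e n M,
    [/\ (0 < M)%N /\ theta <= 2, 0 <= p <= 1, 0 <= e,
        1 / 2 <= ((1 - theta / 2) ^+ 2) ^+ n &
        8 / net_gap_width rho r *
          (4 * (1 - net_gap_width rho r / 8) ^+ (n + n) + 5 / (M + M)%:R) <= e /\
        4 * (p + expR (- p * (d%:R / rho) ^+ (r + r))) + e <=
          (8 * kappa * ln rho + 5) * r%:R * expR (- ((r + r)%:R * (kappa * ln rho)))].
Proof.
move=> r0 t0 tle.
have l0 : 0 < ln rho by rewrite ln_gt0.
have kl0 : 0 < kappa * ln rho by rewrite mulr_gt0.
have r1 : 1 <= r%:R :> R by rewrite ler1n.
set W := (d%:R / rho) ^+ (r + r).
have WE : W = expR ((r + r)%:R * (kappa * ln rho)) by rewrite /W ball_pow.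
set a := (r + r)%:R * (kappa * ln rho) in WE *.
have rr : (r + r)%:R = 2 * r%:R :> R by rewrite natrD; lra.
have a0 : 0 < a by rewrite mulr_gt0// rr mulr_gt0// (lt_le_trans ltr01).
have W0 : 0 < W by rewrite WE expR_gt0.
have W1 : 1 <= W by rewrite WE; apply: le_trans (expR_ge1Dx a); lra.
set w := net_gap_width rho r.
have w0 : 0 < w by apply: net_gap_width_gt0 r0; exact: ltW.
have w1 : w <= 1 by apply: net_gap_width_le1 r0; exact: ltW.
have wE : w^-1 = expR ((r + r)%:R * ln rho) * (r + r)%:R.
  by rewrite /w /net_gap_width rho_pow invfM invrK invrK.
(* [n] makes [(1 - w / 8)^(2n) <= exp (- n w / 4)] at most [w / (64 W)], and [M] makes [5 / (2M)] at
   most [w / (16 W)]; the total error is then at most [1 / W]. *)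
pose n := (Num.trunc (4 / w * ln (64 * W / w))).+1.
pose M := (Num.trunc (40 * W / w)).+1.
have Ww : 1 <= W / w by rewrite ler_pdivlMr// mul1r (le_trans w1).
have q1 : 1 <= 64 * W / w by rewrite -mulrA; lra.
have M_gt : 40 * W / w < M%:R.
  by case/andP: (@truncn_itv _ (40 * W / w) ltac:(by rewrite -mulrA; lra)).
have lnq0 : 0 <= 4 / w * ln (64 * W / w) by rewrite mulr_ge0 ?ln_ge0// divr_ge0// ltW.
have /andP[n_le n_gt] := truncn_itv lnq0; rewrite -/n in n_gt.
set E := expR ((r + r)%:R * ln rho) in wE tle *.
have E1 : 1 <= E.
  apply: le_trans (expR_ge1Dx _); rewrite lerDl mulr_ge0// ltW//.
have r2 : 1 <= r%:R ^+ 2 * E by rewrite -[leLHS]mulr1 ler_pM// exprn_ege1.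
have lnq : ln (64 * W / w) <= r%:R * (128 + 2 * kappa * ln rho + 2 * ln rho).
  have -> : 64 * W / w = (128 * r%:R) * expR (a + (r + r)%:R * ln rho).
    rewrite wE WE expRD -/E rr; lra.
  have r128 : 0 < 128 * r%:R :> R by rewrite mulr_gt0// (lt_le_trans ltr01).
  rewrite lnM ?posrE ?expR_gt0// expRK /a rr.
  have := ltW (ln_sublinear r128); lra.
have n_bound : n%:R <= scale_const * r%:R ^+ 2 * E.
  set X := 128 + 2 * kappa * ln rho + 2 * ln rho in lnq.
  have -> : scale_const * r%:R ^+ 2 * E = 8 * X * r%:R ^+ 2 * E + r%:R ^+ 2 * E.
    by rewrite /scale_const -/X; lra.
  rewrite /n -natr1; apply: lerD => //; apply: (le_trans n_le).
  have := ler_wpM2l (_ : 0 <= 4 / w) lnq => /(_ (divr_ge0 (ler0n _ 4) (ltW w0))).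
  by move=> /le_trans; apply; rewrite wE rr expr2; lra.
have n_gt0 : (0 < n)%N by [].
have M_gt0 : (0 < M)%N by [].
clearbody n M.
(* By Bernoulli's inequality this keeps [(1 - theta / 2)^(2n)] above [1 / 2]. *)
have tn : n%:R * theta <= 1 / 2.
  by rewrite mulrC; apply: le_trans tle; rewrite ler_pM2l.
have t1 : theta <= 1 / 2.
  by apply: le_trans tn; apply: ler_peMl (ltW t0) _; rewrite ler1n.
(* Since [a = ln W], the choice [p = a / W] minimises [p + exp (- p W)]; the exponential and the
   error [e] are then both [1 / W]. *)
exists (a / W), W^-1, n, M; split => //.
- by split => //; lra.
- apply/andP; split; first by rewrite divr_ge0// ltW.
  by rewrite ler_pdivrMr// mul1r WE; apply: le_trans (expR_ge1Dx a); lra.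
- by rewrite invr_ge0 ltW.
- rewrite -exprM; apply: le_trans (bernoulli_le (2 * n) _); last by lra.
  by rewrite natrM; lra.
split; last first.
  rewrite mulNr divfK ?gt_eqF// expRN -WE.
  have -> : 4 * (a / W + W^-1) + W^-1 = (4 * a + 5) / W by lra.
  rewrite ler_pM2r ?invr_gt0// /a rr.
  have := ler_wpM2l (ltW kl0) r1; nra.
have p1 : (1 - w / 8) ^+ (n + n) <= w / (64 * W).
  apply: (@le_trans _ _ (expR (- (w / 8)) ^+ (n + n))).
    rewrite lerXn2r ?nnegrE ?expR_ge0//; last by have := expR_ge1Dx (- (w / 8)).
    by lra.
  have -> : w / (64 * W) = expR (- ln (64 * W / w)).
    by rewrite expRN lnK ?posrE ?(lt_le_trans ltr01 q1)// invf_div.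
  rewrite -expRM_natr ler_expR natrD mulNr lerN2.
  by have := ltW n_gt; rewrite mulrAC ler_pdivrMr//; lra.
have p2 : 5 / (M + M)%:R <= w / (16 * W).
  have M0 : 0 < M%:R :> R by rewrite ltr0n.
  rewrite natrD ler_pdivrMr; last lra.
  rewrite mulrAC ler_pdivlMr; last lra.
  have := ltW M_gt; rewrite ler_pdivrMr//; lra.
apply: (@le_trans _ _ (8 / w * (4 * (w / (64 * W)) + w / (16 * W)))).
  apply: ler_wpM2l; first by rewrite divr_ge0// ltW.
  by apply: lerD => //; rewrite ler_pM2l.
have -> : 8 / w * (4 * (w / (64 * W)) + w / (16 * W)) = w / w * W^-1.
  by rewrite !invfM; lra.
by rewrite divff ?gt_eqF// mul1r.
Qed.

(** With [L = - ln theta], take for [r] the integer part of [alpha L]. Then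
    [rho^(2r) <= theta^(eta - 1)], and the spare factor [theta^eta] beats the polynomial in [r]. *)
Lemma choose_radius (eps : R) : 0 < eps -> eps <= kappa ->
  exists C L0 : R, 0 <= C /\ forall theta, 0 < theta -> L0 <= - ln theta ->
    exists2 r : nat, (0 < r)%N &
      theta * (scale_const * r%:R ^+ 2 * expR ((r + r)%:R * ln rho)) <= 1 / 2 /\
      (8 * kappa * ln rho + 5) * r%:R *
        expR (- ((r + r)%:R * (kappa * ln rho))) <= C * theta `^ (kappa - eps).
Proof.
move=> eps0 eps_kappa.
have l0 : 0 < ln rho by rewrite ln_gt0.
have kl0 : 0 < kappa * ln rho by rewrite mulr_gt0.
have c0 : 0 < scale_const by rewrite /scale_const; lra.
(* [eta] costs [eta * kappa = eps / 2] in the exponent; the other half of [eps] pays for the factor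
   [r]. *)
pose eta := eps / (2 * kappa).
have eta0 : 0 < eta by rewrite divr_gt0// mulr_gt0.
have etaE : eta * kappa = eps / 2.
  by rewrite /eta invfM; rewrite mulrA mulfVK ?gt_eqF.
have eta_half : eta <= 1 / 2.
  by rewrite /eta ler_pdivrMr ?mulr_gt0//; lra.
pose alpha := (1 - eta) / (2 * ln rho).
have alpha0 : 0 < alpha by rewrite divr_gt0 ?mulr_gt0//; lra.
have alphaE : 2 * alpha * ln rho = 1 - eta.
  rewrite -[RHS](@divfK _ (2 * ln rho)) -/alpha; first by lra.
  by rewrite gt_eqF// mulr_gt0.
pose C0 := 8 * kappa * ln rho + 5.
(* From [exp x >= x^3 / 6] at [x = eta L]: for [L >= B0], [scale_const (alpha L)^2] is at most half
   of [exp (eta L)]. *)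
pose B0 := 12 * scale_const * alpha ^+ 2 / eta ^+ 3.
clearbody eta alpha.
have C00 : 0 < C0 by rewrite /C0; lra.
have B00 : 0 < B0 by rewrite /B0 divr_gt0 ?mulr_gt0 ?exprn_gt0.
(* [alpha^-1] ensures [r >= 1]; the exponential factor pays for rounding [alpha L] down, and
   [2 / eps] for bounding [L] by a multiple of [exp (eps L / 2)]. *)
exists (C0 * alpha * expR (2 * (kappa * ln rho)) * (2 / eps)), (alpha^-1 + B0); split.
  by rewrite !mulr_ge0 ?expR_ge0 ?invr_ge0 ?(ltW C00) ?(ltW alpha0) ?(ltW eps0)//.
move=> theta t0; set L := - ln theta => L0.
have thetaE : theta = expR (- L) by rewrite /L opprK lnK.
have powE s : theta `^ s = expR (- (s * L)).
  by rewrite /powR gt_eqF// /L mulrN opprK.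
clearbody L.
have ai0 : 0 < alpha^-1 by rewrite invr_gt0.
have L_gt0 : 0 < L by lra.
have aL1 : 1 <= alpha * L by rewrite -ler_pdivrMl// mulr1; lra.
have LB : B0 <= L by lra.
have /andP[] := @truncn_itv _ (alpha * L) (le_trans ler01 aL1).
have r_gt0 : (0 < Num.trunc (alpha * L))%N by rewrite truncn_gt0.
move: (Num.trunc _) r_gt0 => r r_gt0 r_le; rewrite -natr1 => r_gt.
have r1 : 1 <= r%:R :> R by rewrite ler1n.
have rr : (r + r)%:R = 2 * r%:R :> R by rewrite natrD; lra.
have rl_le : (r + r)%:R * ln rho <= (1 - eta) * L.
  by rewrite -alphaE rr; have := ler_wpM2r (ltW l0) r_le; lra.
exists r => //; split.
- apply: (@le_trans _ _ (expR (- L) *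
      (scale_const * (alpha * L) ^+ 2 * expR ((1 - eta) * L)))).
    rewrite thetaE ler_pM2l ?expR_gt0//; apply: ler_pM; rewrite ?expR_ge0 ?ler_expR//.
      by rewrite mulr_ge0 ?sqr_ge0// ltW.
    by rewrite ler_pM2l// lerXn2r ?nnegrE// mulr_ge0// ltW.
  rewrite mulrCA -expRD (_ : - L + (1 - eta) * L = - (eta * L)); last lra.
  rewrite expRN ler_pdivrMr ?expR_gt0//.
  have etaL : 0 <= eta * L by rewrite mulr_ge0// ltW.
  have := expR_ge1Dxn 2 etaL; rewrite (_ : 3`!%:R = 6 :> R)// => e6.
  apply: (@le_trans _ _ (1 / 2 * ((eta * L) ^+ 3 / 6))); last by lra.
  have : B0 * eta ^+ 3 <= L * eta ^+ 3 by rewrite ler_pM2r// exprn_gt0.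
  rewrite /B0 divfK ?gt_eqF ?exprn_gt0// => h.
  have := ler_wpM2r (sqr_ge0 L) h; rewrite !exprMn.
  have -> : L * eta ^+ 3 * L ^+ 2 = eta ^+ 3 * L ^+ 3 by rewrite (exprS L 2); lra.
  lra.
- rewrite powE -/C0.
  have e1 : expR (- ((r + r)%:R * (kappa * ln rho))) <=
      expR (2 * (kappa * ln rho)) * expR (- ((kappa - eps / 2) * L)).
    rewrite -expRD ler_expR rr -etaE.
    have := ler_wpM2r (ltW kl0) (ltW r_gt).
    have -> : alpha * L * (kappa * ln rho) = (1 - eta) * kappa * L / 2.
      by rewrite -alphaE; lra.
    lra.
  have e2 : L <= 2 / eps * expR (eps / 2 * L).
    apply: (@le_trans _ _ (2 / eps * (eps / 2 * L))).
      by rewrite mulrA -(invf_div eps 2) mulVf ?mul1r// gt_eqF// divr_gt0.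
    apply: ler_wpM2l; first by rewrite divr_ge0// ltW.
    by have := expR_ge1Dx (eps / 2 * L); lra.
  have e3 : expR (- ((kappa - eps) * L)) =
      expR (eps / 2 * L) * expR (- ((kappa - eps / 2) * L)).
    by rewrite -expRD; congr expR; lra.
  rewrite e3; set X := expR (- ((kappa - eps / 2) * L)) in e1 *.
  set Y := expR (2 * (kappa * ln rho)) in e1 *.
  set F := expR (eps / 2 * L) in e2 *.
  have X0 : 0 <= X by exact: expR_ge0.
  have Y0 : 0 <= Y by exact: expR_ge0.
  apply: (@le_trans _ _ (C0 * (alpha * L) * (Y * X))).
    apply: ler_pM; [by rewrite mulr_ge0// ltW|exact: expR_ge0|by rewrite ler_pM2l|].
    exact: e1.
  have := ler_wpM2l (_ : 0 <= C0 * alpha * Y * X) e2.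
  move=> /(_ ltac:(by rewrite !mulr_ge0// ltW)); lra.
Qed.

End ParameterChoice.

(** * The power law at the spectral edge *)

Theorem theorem2p5 (R : realType) (d : nat) (rho eps : R) (eps_gt0 : 0 < eps) :
  exists K : R,
    forall (disp : measure_display) (T : measurableType disp)
      (P : probability T R) (X : T -> rooted_graph d)
      (PG : regular_graph d -> set R -> (nat -> R) -> nat -> R),
    random_rooted_graph X ->
    unimodular P X ->
    {ae P, forall w, nonamenable R (X w).1} ->
    {ae P, forall w, opnorm (adjacency (R := R) (X w).1) = rho} ->
    (forall G : regular_graph d, spectral_projections (adjacency G) (PG G)) ->
    forall theta : R, 0 < theta ->
    theta <= 2 \/ 0 <= ln d%:R / ln rho - 1 - eps ->
    (spectral_distribution P X PG `[(rho * (1 - theta))%R, rho] <=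
     (K * theta `^ (ln d%:R / ln rho - 1 - eps))%:E)%E.
Proof.
set s := _ - eps; have [s_lt0|s_ge0] := ltP s 0.
  (* For [s < 0] the distribution is at most [1], and [theta <= 2] gives [theta^s >= 2^s]. *)
  exists (2 `^ (- s)) => disp T P X PG _ _ _ _ PGP theta t0 [t2|]; last first.
    by move=> h; move: s_lt0; rewrite ltNge h.
  apply: le_trans (spectral_distribution_le1 P X PGP _) _ => //.
  rewrite lee_fin -[s in theta `^ s]opprK [theta `^ _]powRN.
  rewrite ler_pdivlMr ?powR_gt0// mul1r.
  by apply: ge0_ler_powR; rewrite ?nnegrE ?oppr_ge0// ltW.
pose kappa := ln d%:R / ln rho - 1.
have eps_kappa : eps <= kappa by rewrite -subr_ge0.
have kappa_gt0 : 0 < kappa := lt_le_trans eps_gt0 eps_kappa.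
(* A positive ratio rules out the default values of [ln] and of division, which forces [0 < d] and
   [1 < rho]. *)
have ratio : 0 < ln d%:R / ln rho by rewrite /kappa in kappa_gt0; lra.
have d_gt0 : (0 < d)%N.
  by rewrite lt0n; apply/eqP => d0; move: ratio; rewrite d0 ln0// mul0r ltxx.
have lnd_ge0 : 0 <= ln d%:R :> R by rewrite ln_ge0// ler1n.
have lnrho_gt0 : 0 < ln rho.
  rewrite ltNge; apply/negP => h; move: ratio; rewrite ltNge => /negP; apply.
  by rewrite mulr_ge0_le0// invr_le0.
have rho_gt1 : 1 < rho.
  by rewrite ltNge; apply/negP => /ln_le0; rewrite leNgt lnrho_gt0.
have ln_d : ln d%:R = (1 + kappa) * ln rho.
  by rewrite /kappa addrC subrK divfK// gt_eqF.
have [C [L0 [C0 radius_ex]]] := choose_radius rho_gt1 kappa_gt0 eps_gt0 eps_kappa.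
(* [C] serves small [theta]; once [- ln theta < L0], the second summand times [theta^s] is at least
   [1], which bounds the distribution. *)
exists (C + expR (L0 * s)) => disp T P X PG _ uni _ normA PGP theta t0 _.
have ts_ge0 : 0 <= theta `^ s by exact: powR_ge0.
have [tL|tL] := leP L0 (- ln theta).
  have [r r0 [r1 r2]] := radius_ex _ t0 tL.
  have [p [e [n [M [[M0 t2] p01 e0 cn [eE bound]]]]]] :=
    choose_parameters d_gt0 rho_gt1 ln_d kappa_gt0 r0 t0 r1.
  apply: le_trans (spectral_distribution_le PGP uni normA (ltW rho_gt1) d_gt0 r0
    M0 p01 t0 t2 cn eE e0) _.
  rewrite lee_fin (le_trans bound)// (le_trans r2)// ler_wpM2r//.
  by rewrite lerDl expR_ge0.
apply: le_trans (spectral_distribution_le1 P X PGP _) _ => //.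
rewrite lee_fin mulrDl; apply: (@le_trans _ _ (expR (L0 * s) * theta `^ s)).
  rewrite /powR gt_eqF// -expRD -[leLHS]expR0 ler_expR.
  by rewrite [s * _]mulrC -mulrDl mulr_ge0//; lra.
by rewrite lerDr mulr_ge0.
Qed.
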